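(* For $\delta,\rho\in(0,1)$ and a constant $c$ define $$\widetilde{\mathcal{U}}^{\delta}(\delta,\rho)=\rho\log\left(\frac{1}{\delta^2\rho^3}\right)+(1+\rho)\log\left[c\log\left(\frac{1}{\delta^2\rho^3}\right)\right]+3\rho,$$ $$\widetilde{\mathcal{L}}^{\delta}(\delta,\rho)=1-\exp\left(-\frac{3\rho+c}{1-\rho}\right)\cdot\left(\delta^2\rho^3\right)^{\frac{\rho}{1-\rho}}.$$ Fix $\epsilon>0$ and $c>1$. For each $\rho\in(0,1)$ there exists $\delta_0>0$ such that the following holds. In the limit where $k/n\to\rho$ and $n/N\to\delta\in(0,\delta_0)$ as $n\to\infty$, let each $n\times N$ matrix $A$ be sampled with i.i.d. entries from the Gaussian distribution $\mathcal{N}(0,1/n)$. Then $$\mathrm{Prob}\left(L(k,n,N;A)<(1+\epsilon)\,\widetilde{\mathcal{L}}^{\delta}(\delta,\rho)\right)\to1\quad\text{and}\quad \mathrm{Prob}\left(U(k,n,N;A)<\widetilde{\mathcal{U}}^{\delta}(\delta,\rho)+\epsilon\right)\to1$$ exponentially in $n$.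
   Context: Let $\chi^N(k)$ denote the set of vectors in $\mathbb{R}^N$ with at most $k$ nonzero entries. The lower and upper restricted isometry constants of an $n\times N$ matrix $A$ are $$L(k,n,N;A):=1-\min_{x\in\chi^N(k),\,x\ne0}\frac{\|Ax\|_2^2}{\|x\|_2^2},\qquad U(k,n,N;A):=\max_{x\in\chi^N(k),\,x\ne0}\frac{\|Ax\|_2^2}{\|x\|_2^2}-1.$$ Limits are along sequences of positive integer triples $(k,n,N)$ with $k\le n\le N$. The superscript $\delta$ in $\widetilde{\mathcal{U}}^{\delta},\widetilde{\mathcal{L}}^{\delta}$ is only a label, not an exponent. $\log$ is the natural logarithm. ''A probability converges to $1$ exponentially in $n$'' means that one minus the probability is bounded by a function decaying exponentially to zero in $n$. *)

(* Defs.v *)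
From HB Require Import structures.
From mathcomp Require Import all_boot all_order all_algebra.
From mathcomp Require Import all_classical all_reals all_analysis.

Set Implicit Arguments.
Unset Strict Implicit.
Unset Printing Implicit Defensive.

Import Order.TTheory GRing.Theory Num.Theory.
Import numFieldTopology.Exports numFieldNormedType.Exports.

Local Open Scope classical_set_scope.
Local Open Scope ring_scope.

(* MathComp-Analysis equips 'cV[R]_N with the sup norm, hence this definition. *)
Definition norm2 (R : realType) (N : nat) (x : 'cV[R]_N) : R :=
  Num.sqrt (\sum_(i < N) x i 0 ^+ 2).

Definition chi (R : realType) (N k : nat) : set 'cV[R]_N :=
  [set x : 'cV[R]_N | (#|[pred i : 'I_N | x i 0%R != 0%R]| <= k)%N].

Definition sparse_quotients (R : realType) (k n N : nat) (A : 'M[R]_(n, N)) : set R :=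
  [set norm2 (A *m x) ^+ 2 / norm2 x ^+ 2 | x in [set x : 'cV[R]_N | chi k x /\ x != 0]].

(* For 0 < k and 0 < N the infimum and supremum are attained, i.e. they are a
   minimum and a maximum: see sparse_quotients_min and sparse_quotients_max. *)
Definition lower_RIC (R : realType) (k n N : nat) (A : 'M[R]_(n, N)) : R :=
  1 - inf (sparse_quotients k A).

Definition upper_RIC (R : realType) (k n N : nat) (A : 'M[R]_(n, N)) : R :=
  sup (sparse_quotients k A) - 1.

Section attained.
Variables (R : realType) (k n N : nat) (A : 'M[R]_(n, N)).
Hypotheses (k0 : (0 < k)%N) (N0 : (0 < N)%N).

Lemma sqr_norm2 m (x : 'cV[R]_m) : norm2 x ^+ 2 = \sum_(i < m) x i 0 ^+ 2.
Proof. by rewrite sqr_sqrtr// sumr_ge0// => i _; exact: sqr_ge0. Qed.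

Lemma sqr_norm2Z m (a : R) (x : 'cV[R]_m) :
  norm2 (a *: x) ^+ 2 = a ^+ 2 * norm2 x ^+ 2.
Proof.
by rewrite !sqr_norm2 mulr_sumr; apply: eq_bigr => i _; rewrite mxE exprMn.
Qed.

Lemma norm2_neq0 m (x : 'cV[R]_m) : x != 0 -> norm2 x != 0.
Proof.
apply: contraNneq => /(congr1 (fun y => y ^+ 2)).
rewrite sqr_norm2 expr0n /= => /eqP; rewrite psumr_eq0; last first.
  by move=> i _; exact: sqr_ge0.
move=> /allP h; apply/eqP/matrixP => i j; rewrite (ord1 j) mxE.
by have /implyP/(_ isT) := h i (mem_index_enum i); rewrite sqrf_eq0 => /eqP.
Qed.

Lemma continuous_sqr_norm2_mul m (B : 'M[R]_(m, N)) :
  continuous (fun r : 'rV[R]_N => norm2 (B *m r^T) ^+ 2).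
Proof.
have -> : (fun r : 'rV[R]_N => norm2 (B *m r^T) ^+ 2) =
    (fun r => \sum_(i < m) (\sum_(j < N) B i j * r 0 j) ^+ 2).
  apply/funext => r; rewrite sqr_norm2; apply: eq_bigr => i _.
  by rewrite mxE; congr (_ ^+ 2); apply: eq_bigr => j _; rewrite mxE.
apply: (@continuous_big _ _ _ _ xpredT (@add_continuous R^o)) => i _.
have c : continuous (fun r : 'rV[R]_N => \sum_(j < N) B i j * r 0 j).
  apply: (@continuous_big _ _ _ _ xpredT (@add_continuous R^o)) => j _ r.
  exact: (cvgM (cvg_cst _) (@coord_continuous R 1 N 0 j r)).
by move=> r; exact: (cvgM (c r) (c r)).
Qed.

Let sphere : set 'rV[R]_N := [set r | chi k r^T /\ norm2 r^T ^+ 2 = 1].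

Lemma closed_chi : closed [set r : 'rV[R]_N | chi k r^T].
Proof.
rewrite -[X in closed X]setCK closedC openE => r /= /negP; rewrite -ltnNge => kr.
have : nbhs r [set s : 'rV[R]_N | forall i, r 0 i != 0 -> s 0 i != 0].
  apply: (@filter_forall _ _
    (fun i (s : 'rV[R]_N) => r 0 i != 0 -> s 0 i != 0) _
    (nbhs_filter r)) => i.
  have [_|ri0] := eqVneq (r 0 i) 0.
    by apply: filterE.
  have := @coord_continuous R 1 N 0 i r _ (open_nbhs_nbhs (conj (@open_neq R 0) ri0)).
  by apply: (@filterS _ _ (nbhs_filter r)) => s /= ? _.
apply: (@filterS _ _ (nbhs_filter r)) => s h /=; apply/negP; rewrite -ltnNge (leq_trans kr)//.
by apply/subset_leq_card/fintype.subsetP => i; rewrite !inE !mxE; exact: h.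
Qed.

Lemma compact_sphere : compact sphere.
Proof.
apply: bounded_closed_compact.
  exists 1; split => // M M1 r [_ r1]; apply: le_trans (ltW M1).
  rewrite [`|r|]/Num.Def.normr /= mx_normrE; apply: bigmax_le => // -[i j] _ /=.
  rewrite (ord1 i) -(@ler_pXn2r _ 2)// ?nnegrE// expr1n -r1 sqr_norm2.
  rewrite (bigD1 j)//= mxE real_normK ?num_real// lerDl.
  by apply: sumr_ge0 => l _; exact: sqr_ge0.
have -> : sphere = [set r : 'rV[R]_N | chi k r^T] `&`
    (fun r : 'rV[R]_N => norm2 (1%:M *m r^T) ^+ 2) @^-1` [set 1].
  by apply/seteqP; split => r /=; rewrite mul1mx.
apply: closedI; first exact: closed_chi.
apply: preimage_closed => [r _|]; first exact: continuous_sqr_norm2_mul.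
exact: closed_eq.
Qed.

Lemma sphere_neq0 : sphere !=set0.
Proof.
exists (delta_mx 0 (Ordinal N0)); split.
  apply: leq_trans k0.
  apply: leq_trans (_ : #|pred1 (Ordinal N0)| <= 1)%N; last by rewrite card1.
  apply/subset_leq_card/fintype.subsetP => i; rewrite !inE !mxE eqxx /=.
  by case: (i == _) => /=; rewrite ?eqxx.
rewrite sqr_norm2 (bigD1 (Ordinal N0))//= !mxE !eqxx expr1n big1 ?addr0// => i.
by rewrite !mxE eqxx /= => /negPf ->; rewrite expr0n.
Qed.

Lemma sparse_quotientsE :
  sparse_quotients k A = [set norm2 (A *m r^T) ^+ 2 | r in sphere].
Proof.
apply/seteqP; split => _ [x [xk x0] <-].
  have nx0 := norm2_neq0 x0.
  exists ((norm2 x)^-1 *: x)^T; last first.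
    by rewrite trmxK -scalemxAr sqr_norm2Z exprVn mulrC.
  split; rewrite /= trmxK; last by rewrite sqr_norm2Z exprVn mulVf// sqrf_eq0.
  apply: leq_trans xk; apply/subset_leq_card/fintype.subsetP => i; rewrite !inE mxE.
  by apply: contraNneq => ->; rewrite mulr0.
exists x^T; last by rewrite x0 divr1.
split=> //; apply/eqP => x00; move: x0; rewrite x00 sqr_norm2 big1 => [/eqP|i _].
  by rewrite eq_sym oner_eq0.
by rewrite mxE expr0n.
Qed.

Lemma sparse_quotients_min : sparse_quotients k A (inf (sparse_quotients k A)) /\
  lbound (sparse_quotients k A) (inf (sparse_quotients k A)).
Proof.
have [c] := compact_EVT_min sphere_neq0 compact_sphere
  (continuous_subspaceT (@continuous_sqr_norm2_mul _ A)).
rewrite inE => cS cmin.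
have lb : lbound (sparse_quotients k A) (norm2 (A *m c^T) ^+ 2).
  by rewrite sparse_quotientsE => _ [r rS <-]; apply: cmin; rewrite inE.
have mem : sparse_quotients k A (norm2 (A *m c^T) ^+ 2).
  by rewrite sparse_quotientsE; exists c.
suff -> : inf (sparse_quotients k A) = norm2 (A *m c^T) ^+ 2 by [].
apply/eqP; rewrite eq_le ge_inf ?lb_le_inf//=; first by exists (norm2 (A *m c^T) ^+ 2).
by exists (norm2 (A *m c^T) ^+ 2).
Qed.

Lemma sparse_quotients_max : sparse_quotients k A (sup (sparse_quotients k A)) /\
  ubound (sparse_quotients k A) (sup (sparse_quotients k A)).
Proof.
have [c] := compact_EVT_max sphere_neq0 compact_sphere
  (continuous_subspaceT (@continuous_sqr_norm2_mul _ A)).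
rewrite inE => cS cmax.
have ub : ubound (sparse_quotients k A) (norm2 (A *m c^T) ^+ 2).
  by rewrite sparse_quotientsE => _ [r rS <-]; apply: cmax; rewrite inE.
have mem : sparse_quotients k A (norm2 (A *m c^T) ^+ 2).
  by rewrite sparse_quotientsE; exists c.
suff -> : sup (sparse_quotients k A) = norm2 (A *m c^T) ^+ 2 by [].
apply/eqP; rewrite eq_le ge_sup//=; last by exists (norm2 (A *m c^T) ^+ 2).
by apply: ub_le_sup => //; exists (norm2 (A *m c^T) ^+ 2).
Qed.

End attained.

Definition U_delta (R : realType) (c delta rho : R) : R :=
  rho * ln (1 / (delta ^+ 2 * rho ^+ 3))
  + (1 + rho) * ln (c * ln (1 / (delta ^+ 2 * rho ^+ 3)))
  + 3 * rho.

Definition L_delta (R : realType) (c delta rho : R) : R :=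
  1 - expR (- ((3 * rho + c) / (1 - rho)))
      * (delta ^+ 2 * rho ^+ 3) `^ (rho / (1 - rho)).

Definition mutually_independent (R : realType) (d : measure_display)
    (T : measurableType d) (P : probability T R) (I : finType)
    (X : I -> {RV P >-> R}) : Prop :=
  forall (J : {set I}) (B : I -> set R), (forall i, measurable (B i)) ->
    P (\bigcap_(i in [set` J]) (X i @^-1` B i))
    = (\prod_(i in J) P (X i @^-1` B i))%E.

(* The second parameter of normal_prob is the standard deviation, so the
   entries have variance n^-1. *)
Definition iid_gaussian_entries (R : realType) (d : measure_display)
    (T : measurableType d) (P : probability T R) (n N : nat)
    (X : 'I_n * 'I_N -> {RV P >-> R}) : Prop :=
  mutually_independent X /\
  forall ij (B : set R), measurable B ->
    distribution P (X ij) B = normal_prob 0 (Num.sqrt (n%:R^-1)) B.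

Definition random_matrix (R : realType) (d : measure_display)
    (T : measurableType d) (P : probability T R) (n N : nat)
    (X : 'I_n * 'I_N -> {RV P >-> R}) (w : T) : 'M[R]_(n, N) :=
  \matrix_(i < n, j < N) X (i, j) w.

(* The constants may depend on the whole sequence; asking for the bound at every
   index m, rather than for all large m, only affects the value of C. *)
Definition to1_exponentially (R : realType) (n : nat -> nat) (p : nat -> \bar R) : Prop :=
  exists C kappa : R, 0 < C /\ 0 < kappa /\
    forall m, (1 - p m <= (C * expR (- (kappa * (n m)%:R)))%:E)%E.

(* Main.v *)
Require Import Defs.
From HB Require Import structures.
From mathcomp Require Import all_boot all_order all_algebra.
From mathcomp Require Import all_classical all_reals all_analysis.
From mathcomp Require Import measurable_realfun ring lra.

Set Implicit Arguments.
Unset Strict Implicit.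
Unset Printing Implicit Defensive.

Import Order.TTheory GRing.Theory Num.Theory.
Import numFieldTopology.Exports numFieldNormedType.Exports.

Local Open Scope classical_set_scope.
Local Open Scope ring_scope.

(** The lower half is elementary. Quotients are nonnegative, so the lower
    constant never exceeds 1, while [L_delta] tends to 1 as [delta] tends to 0;
    for small [delta] the number [(1 + eps) L_delta] is above 1 and the event is
    certain.

    The upper half is a moment argument combined with a union bound over the
    supports. Let [lambda = 1 + U_delta + eps], fix a support [S] of size [k],
    and let [z] be a vector with independent standard normal entries on [S],
    independent of [A]. Average [|A z|^2p] over [z] only. If [|A x|^2] is at
    least [lambda |x|^2] for some nonzero [x] supported on [S], this average is
    at least [(2p-1)!! lambda^p] ([sparse_moment_lower]). Over [A] and [z] together its
    mean is explicit: conditionally on [z] the vector [A z] is normal, so the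
    mean is [n^-p] times the product of the [p]-th moments of the chi-squared
    laws with [k] and [n] degrees of freedom ([expectation_sparse_moment]).
    Markov's inequality bounds the failure probability ([upper_RIC_tail]). With
    [p] close to [n lambda / 2], Stirling-like estimates ([ln_tail_le]) show that
    [2/n] times the logarithm of this bound is at most, asymptotically,

      [rho l + 3 rho + 1 + (1 + rho) log lambda - lambda + 4 / lambda],
      where [l = log (1 / (delta^2 rho^3))].

    By the choice of [lambda] this is
    [(1 + rho) log (lambda / (c l)) - eps + 4 / lambda]. As [delta] tends to 0,
    [lambda] is equivalent to [rho l] and [rho < 1 < c], hence the logarithm is
    negative, [4 / lambda] is below [eps], and the rate is negative
    ([U_delta_threshold]). The slack vanishes when [rho] and [c] are both near 1
    and [eps] near 0, so the additive constant in the rate matters. The moment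
    bound has the right one; the usual covering of the sphere by a net loses a
    factor exponential in [k].

    The moments come from the product rule for independent variables
    ([independent_prod]), from integration by parts for one normal variable
    ([normal_moment]) and from binomial identities ([gauss_momentD],
    [chi2_momentD]). The auxiliary normal vectors are, up to scaling, rows and
    columns of independent copies of [A], so Tonelli's theorem on the square of
    the given probability space suffices. Finally, the event has to be
    measurable for its complement to be estimated; by homogeneity it is
    determined by the integer sparse vectors, of which there are countably
    many. *)

(** * Integration against weighted measures and products of independent variables *)

Section change_of_density.
Context d' (T' : measurableType d') (R : realType).
Import HBNNSimple.
Local Open Scope ereal_scope.

Lemma integral_weighted_nnsfun d (T : measurableType d)
    (mu : {measure set T -> \bar R}) (W : T -> R) (X : T -> T')
    (h : {nnsfun T' >-> R}) :
  measurable_fun setT X -> measurable_fun setT W -> (forall x, 0 <= W x)%R ->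
  \int[mu]_x (W x * h (X x))%:E =
  \sum_(y \in range h) y%:E * \int[mu]_x (W x * \1_(h @^-1` [set y]) (X x))%:E.
Proof.
move=> mX mW W0.
have mI y : measurable_fun setT (fun x => \1_(h @^-1` [set y]) (X x) : R).
  by apply: measurableT_comp => //; exact: measurable_indic.
have h0 y x : (0 <= y%:E * (W x * \1_(h @^-1` [set y]) (X x))%:E).
  rewrite indicE; case: (boolP (_ \in _)) => [|_]; last by rewrite mulr0 mule0.
  by rewrite inE /= => <-; rewrite mule_ge0// lee_fin ?mulr_ge0.
have -> : (fun x => (W x * h (X x))%:E) =
    (fun x => \sum_(y \in range h) y%:E * (W x * \1_(h @^-1` [set y]) (X x))%:E).
  apply/funext => x; rewrite [X in (_ * X)%R](fimfunE h) fsbig_finite//=.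
  rewrite mulr_sumr -sumEFin fsbig_finite//=; apply: eq_bigr => y _.
  by rewrite -EFinM mulrCA.
rewrite ge0_integral_fsum//; last first.
  move=> y; apply: measurable_funeM; apply/measurable_EFinP.
  exact: measurable_funM.
rewrite !fsbig_finite//=; apply: eq_big_seq => y.
rewrite in_fset_set// inE => -[z _ <-].
by rewrite ge0_integralZl_EFin//; [move=> x _; rewrite lee_fin mulr_ge0|
  apply/measurable_EFinP/measurable_funM].
Qed.

(** By approximation with simple functions. It serves to transport integrals
    along a random variable with a density (with [W = 1]) and to split off an
    independent factor (with [g] constant). *)
Lemma integral_weighted_ge0 d (T : measurableType d)
    (mu : {measure set T -> \bar R}) (nu : {measure set T' -> \bar R})
    (X : T -> T') (W : T -> R) (g : T' -> R) (f : T' -> R) :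
  measurable_fun setT X -> measurable_fun setT W -> measurable_fun setT g ->
  (forall x, 0 <= W x)%R -> (forall y, 0 <= g y)%R ->
  (forall B, measurable B ->
    \int[mu]_x (W x * \1_B (X x))%:E = \int[nu]_y (g y * \1_B y)%:E) ->
  measurable_fun setT f -> (forall y, 0 <= f y)%R ->
  \int[mu]_x (W x * f (X x))%:E = \int[nu]_y (g y * f y)%:E.
Proof.
move=> mX mW mg W0 g0 Wg mf f0.
have mEf : measurable_fun setT (EFin \o f) by exact/measurable_EFinP.
pose h := nnsfun_approx measurableT mEf.
have approx d0 (S : measurableType d0) (r : {measure set S -> \bar R})
    (V : S -> R) (Y : S -> T') :
    measurable_fun setT Y -> measurable_fun setT V -> (forall x, 0 <= V x)%R ->
    \int[r]_x (V x * f (Y x))%:E = limn (fun n => \int[r]_x (V x * h n (Y x))%:E).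
  move=> mY mV V0; rewrite -monotone_convergence//.
  - apply: eq_integral => x _; apply/esym/cvg_lim => //.
    under eq_fun do rewrite EFinM.
    rewrite EFinM; apply: cvgeZl => //.
    by apply: cvg_nnsfun_approx => // y _; rewrite /= lee_fin.
  - move=> n; apply/measurable_EFinP/measurable_funM => //.
    exact: (measurableT_comp (measurable_funP _)).
  - by move=> n x _; rewrite lee_fin mulr_ge0.
  - move=> x _ a b ab; rewrite lee_fin ler_wpM2l//.
    by have /lefP := nd_nnsfun_approx measurableT mEf ab; exact.
rewrite !approx//; congr (limn _); apply/funext => n.
rewrite (integral_weighted_nnsfun mu (h n) mX mW W0).
rewrite (integral_weighted_nnsfun nu (h n) (X := idfun)) //; last first.
  exact: measurable_id.
by apply: eq_fsbigr => y _; rewrite Wg//; exact: measurable_funPTI.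
Qed.

End change_of_density.

Section independence.
Context d (T : measurableType d) (R : realType) (P : probability T R).
Variables (I : finType) (X : I -> {RV P >-> R}).
Hypothesis indepX : mutually_independent X.
Local Open Scope ereal_scope.

Let measurable_prodX (g : I -> R -> R) : (forall i, measurable_fun setT (g i)) ->
  measurable_fun setT (fun w => \prod_i g i (X i w))%R.
Proof.
by move=> mg; apply: measurable_prod => i _; apply: measurableT_comp.
Qed.

(** Independence is the case of indicators. The indicators are replaced by
    arbitrary functions one variable at a time: when all factors but the [j]-th
    are fixed, both sides are integrals of the [j]-th one against measures that
    agree on indicators. *)
Lemma independent_prod_ge0 (g : I -> R -> R) :
  (forall i, measurable_fun setT (g i)) -> (forall i y, 0 <= g i y)%R ->
  (forall i, \int[P]_w (g i (X i w))%:E < +oo) ->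
  \int[P]_w (\prod_i g i (X i w))%:E = \prod_i \int[P]_w (g i (X i w))%:E.
Proof.
suff main (s : seq I) : forall h : I -> R -> R,
    (forall i, measurable_fun setT (h i)) -> (forall i y, 0 <= h i y)%R ->
    (forall i, \int[P]_w (h i (X i w))%:E < +oo) ->
    (forall i, i \notin s -> exists2 B, measurable B & h i = \1_B) ->
    \int[P]_w (\prod_i h i (X i w))%:E = \prod_i \int[P]_w (h i (X i w))%:E.
  move=> mg g0 gfin; apply: (main (enum I)) => // i.
  by rewrite mem_enum.
elim: s => [|j s ih] h mh h0 hfin hB.
  have {hB}/choice[B hB] : forall i, exists B, measurable B /\ h i = \1_B.
    by move=> i; have [B] := hB i erefl; exists B.
  have mB i := (hB i).1.
  under eq_bigr => i _ do under eq_integral => w _ do rewrite (hB i).2.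
  have -> : (fun w => (\prod_i h i (X i w))%:E) =
      EFin \o \1_(\bigcap_(i in [set` [set: I]%SET]) (X i @^-1` B i)).
    apply/funext => w /=; congr (_%:E); rewrite indicE.
    case: (boolP (w \in _)) => [|/negP]; rewrite inE /= => wB.
      rewrite big1// => i _; rewrite (hB i).2 indicE mem_set//.
      by apply: (wB i); rewrite /= inE.
    have /existsNP[i /not_implyP[_ /= wi]] := wB.
    by apply/eqP/prodf_eq0; exists i => //; rewrite (hB i).2 indicE memNset.
  have mXB i : measurable (X i @^-1` B i) by exact: measurable_funPTI.
  rewrite integral_indic ?setIT//=; last exact: fin_bigcap_measurable.
  rewrite indepX//; apply: eq_big => [i|i _]; first by rewrite inE.
  rewrite (_ : (fun w => _) = EFin \o \1_(X i @^-1` B i))//.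
  by rewrite integral_indic ?setIT.
pose e i := \int[P]_w (h i (X i w))%:E.
have e0 i : 0 <= e i by apply: integral_ge0 => w _; rewrite lee_fin.
have eE i : e i = (fine (e i))%:E.
  by rewrite fineK// ge0_fin_numE//; exact: hfin.
pose W w := (\prod_(i | i != j) h i (X i w))%R.
have mhX i : measurable_fun setT (fun w => h i (X i w)).
  exact: measurableT_comp.
have mW : measurable_fun setT W.
  rewrite (_ : W = fun w => (\prod_(i <- enum (predC1 j)) h i (X i w))%R).
    by apply: measurable_prod => i _; exact: mhX.
  by apply/funext => w; rewrite big_enum.
have WB B : measurable B -> \int[P]_w (W w * \1_B (X j w))%:E =
    \int[distribution P (X j)]_y
      ((\prod_(i | i != j) fine (e i)) * \1_B y)%:E.
  move=> mB; pose h' i := if i == j then \1_B else h i.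
  have h'E i : i != j -> h' i = h i by rewrite /h' => /negPf ->.
  have h'j : h' j = \1_B by rewrite /h' eqxx.
  have -> : \int[P]_w (W w * \1_B (X j w))%:E =
      \int[P]_w (\prod_i h' i (X i w))%:E.
    apply: eq_integral => w _; rewrite (bigD1 j)//= h'j mulrC.
    by congr (_ * _)%:E; apply: eq_bigr => i ij; rewrite h'E.
  rewrite ih.
  - rewrite (bigD1 j)//= h'j muleC.
    rewrite (eq_bigr (fun i => (fine (e i))%:E)); last first.
      by move=> i ij; rewrite -eE h'E.
    rewrite prodEFin; under [RHS]eq_integral do rewrite EFinM.
    rewrite ge0_integralZl_EFin//; last 2 first.
      by apply/measurable_EFinP; exact: measurable_indic.
      by apply: prodr_ge0 => i _; rewrite fine_ge0.
    by rewrite ge0_integral_distribution//; apply/measurable_EFinP; exact: measurable_indic.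
  - by move=> i; rewrite /h'; case: ifP => // _; exact: measurable_indic.
  - by move=> i y; rewrite /h'; case: ifP.
  - move=> i; rewrite /h'; case: ifP => // _.
    rewrite (_ : (fun w => _) = EFin \o \1_(X i @^-1` B))//.
    have mXB : measurable (X i @^-1` B) by exact: measurable_funPTI.
    by rewrite integral_indic ?setIT// (le_lt_trans (probability_le1 _ _))// ltry.
  - move=> i is'; have [->|ij] := eqVneq i j; first by exists B.
    by rewrite h'E//; apply: hB; rewrite inE negb_or ij.
transitivity (\int[P]_w (W w * h j (X j w))%:E).
  by apply: eq_integral => w _; rewrite (bigD1 j)//= mulrC.
rewrite (integral_weighted_ge0 _ _ _ _ _ WB)//; last 2 first.
- by move=> w; apply: prodr_ge0.
- by move=> _; apply: prodr_ge0 => i _; rewrite fine_ge0.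
under eq_integral do rewrite EFinM.
rewrite ge0_integralZl_EFin//; last 3 first.
  by move=> y _; rewrite lee_fin.
  exact/measurable_EFinP.
  by apply: prodr_ge0 => i _; rewrite fine_ge0.
rewrite ge0_integral_distribution//; last 2 first.
- exact/measurable_EFinP.
- by move=> y; rewrite lee_fin.
rewrite [RHS](bigD1 j)//= muleC -prodEFin; congr (_ * _).
by apply: eq_bigr => i _; rewrite -eE.
Qed.

(** Integrability follows from the nonnegative case applied to absolute values;
    then each signed factor is split into its positive and negative parts, one
    variable at a time. *)
Lemma independent_prod (g : I -> R -> R) :
  (forall i, measurable_fun setT (g i)) ->
  (forall i, P.-integrable setT (fun w => (g i (X i w))%:E)) ->
  P.-integrable setT (fun w => (\prod_i g i (X i w))%:E) /\
  (\int[P]_w (\prod_i g i (X i w)) = \prod_i \int[P]_w (g i (X i w)))%R.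
Proof.
pose itg (f : R -> R) i := P.-integrable setT (fun w => (f (X i w))%:E).
have ge0 (h : I -> R -> R) : (forall i, measurable_fun setT (h i)) ->
    (forall i, itg (h i) i) -> (forall i y, 0 <= h i y)%R ->
    \int[P]_w (\prod_i h i (X i w))%:E =
      ((\prod_i \int[P]_w (h i (X i w)))%R)%:E.
  move=> mh ih h0; rewrite independent_prod_ge0//; last first.
    move=> i; have /integrableP[_] := ih i; apply: le_lt_trans.
    rewrite le_eqVlt; apply/orP; left; apply/eqP/eq_integral => w _.
    by rewrite /= ger0_norm.
  rewrite -prodEFin; apply: eq_bigr => i _.
  by rewrite /Rintegral fineK//; apply: integrable_fin_num => //; exact: ih.
have intg (h : I -> R -> R) : (forall i, measurable_fun setT (h i)) ->
    (forall i, itg (h i) i) ->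
    P.-integrable setT (fun w => (\prod_i h i (X i w))%:E).
  move=> mh ih; apply/integrableP; split.
    exact/measurable_EFinP/measurable_prodX.
  have -> : \int[P]_w `|(\prod_i h i (X i w))%:E| =
      \int[P]_w (\prod_i `|h i (X i w)|)%:E.
    by apply: eq_integral => w _; rewrite /= normr_prod.
  pose nh i y := `|h i y|%R.
  have mnh i : measurable_fun setT (nh i) by exact: measurableT_comp.
  have inh i : itg (nh i) i.
    exact: (@integrable_norm _ _ _ P setT (h i \o X i) (ih i)).
  by rewrite (ge0 nh) ?ltry// => i y; exact: normr_ge0.
move=> mg ig; split; first exact: intg.
suff main (s : seq I) : forall h : I -> R -> R,
    (forall i, measurable_fun setT (h i)) -> (forall i, itg (h i) i) ->
    (forall i, i \notin s -> forall y, 0 <= h i y)%R ->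
    (\int[P]_w (\prod_i h i (X i w)) = \prod_i \int[P]_w (h i (X i w)))%R.
  by apply: (main (enum I)) => // i; rewrite mem_enum.
elim: s => [|j s ih] h mh hi h0; first by rewrite /Rintegral ge0// => i; exact: h0.
pose hp i := if i == j then (h j)^\+%R else h i.
pose hn i := if i == j then (h j)^\-%R else h i.
have hpE i : i != j -> hp i = h i by rewrite /hp => /negPf ->.
have hnE i : i != j -> hn i = h i by rewrite /hn => /negPf ->.
have hjE y : h j y = (hp j y - hn j y)%R.
  by rewrite /hp /hn eqxx -[in LHS](funrposBneg (h j)).
have mhp i : measurable_fun setT (hp i).
  by rewrite /hp; case: ifP => // _; exact: measurable_funrpos.
have mhn i : measurable_fun setT (hn i).
  by rewrite /hn; case: ifP => // _; exact: measurable_funrneg.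
have ihp i : itg (hp i) i.
  have [->|ij] := eqVneq i j; last by rewrite hpE.
  rewrite /hp eqxx.
  exact: (@integrable_funrpos _ _ _ P setT (h j \o X j) measurableT (hi j)).
have ihn i : itg (hn i) i.
  have [->|ij] := eqVneq i j; last by rewrite hnE.
  rewrite /hn eqxx.
  exact: (@integrable_funrneg _ _ _ P setT (h j \o X j) measurableT (hi j)).
have posp i : i \notin s -> forall y, (0 <= hp i y)%R.
  have [->|ij] := eqVneq i j; last first.
    by rewrite hpE// => is' y; apply: h0; rewrite inE negb_or ij.
  by move=> _ y; rewrite /hp eqxx; exact: funrpos_ge0.
have posn i : i \notin s -> forall y, (0 <= hn i y)%R.
  have [->|ij] := eqVneq i j; last first.
    by rewrite hnE// => is' y; apply: h0; rewrite inE negb_or ij.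
  by move=> _ y; rewrite /hn eqxx; exact: funrneg_ge0.
have bigDj (F : I -> R) : (\prod_i F i = F j * \prod_(i | i != j) F i)%R.
  exact: bigD1.
transitivity (\int[P]_w (\prod_i hp i (X i w) - \prod_i hn i (X i w)))%R.
  apply: eq_Rintegral => w _; rewrite !bigDj hjE mulrBl.
  by congr (_ * _ - _ * _)%R; apply: eq_bigr => i ij; rewrite ?hpE ?hnE.
rewrite RintegralB//; [|exact: intg..].
rewrite !ih// !bigDj; under [in RHS]eq_Rintegral do rewrite hjE.
rewrite RintegralB//; [|exact: ihp|exact: ihn].
by rewrite mulrBl; congr (_ * _ - _ * _)%R; apply: eq_bigr => i ij; rewrite ?hpE ?hnE.
Qed.

End independence.

(** * Moments of normal and chi-squared laws: binomial identities *)

(** The [p]-th moment of the chi-squared law with [m] degrees of freedom; for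
    [m = 1] it is the double factorial [1 * 3 * ... * (2p - 1)]. *)
Definition chi2_moment (m p : nat) : nat := (\prod_(i < p) (m + i.*2))%N.

Lemma chi2_momentS m p : chi2_moment m p.+1 = (chi2_moment m p * (m + p.*2))%N.
Proof. by rewrite /chi2_moment big_ord_recr. Qed.

Lemma chi2_moment0 m : chi2_moment m 0 = 1%N.
Proof. by rewrite /chi2_moment big_ord0. Qed.

Lemma chi2_moment_gt0 (R : numDomainType) m p : (0 < m)%N ->
  0 < (chi2_moment m p)%:R :> R.
Proof.
move=> m0; rewrite ltr0n /chi2_moment prodn_gt0// => i.
by rewrite addn_gt0 m0.
Qed.

(** Degrees of freedom add up for independent chi-squared variables; this is
    the Vandermonde identity for rising products. *)
Lemma chi2_momentD m l p : chi2_moment (m + l) p =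
  (\sum_(b < p.+1) 'C(p, b) * (chi2_moment m (p - b) * chi2_moment l b))%N.
Proof.
elim: p => [|p ih]; first by rewrite big_ord_recl big_ord0 !chi2_moment0.
rewrite chi2_momentS ih big_distrl/=.
rewrite (eq_bigr (fun b : 'I_p.+1 =>
    'C(p, b) * (chi2_moment m (p.+1 - b) * chi2_moment l b) +
    'C(p, b) * (chi2_moment m (p - b) * chi2_moment l b.+1)))%N; last first.
  move=> b _; have bp : (b <= p)%N by rewrite -ltnS.
  rewrite subSn// !chi2_momentS.
  have -> : (m + l + p.*2 = (m + (p - b).*2) + (l + b.*2))%N.
    by rewrite -{1}(subnK bp) doubleD addnACA.
  by ring.
rewrite big_split/= [in RHS]big_ord_recl [X in (X + _)%N = _]big_ord_recl.
rewrite [in RHS](eq_bigr (fun i : 'I_p.+1 =>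
    'C(p, i) * (chi2_moment m (p - i) * chi2_moment l i.+1) +
    'C(p, i.+1) * (chi2_moment m (p - i) * chi2_moment l i.+1)))%N; last first.
  by move=> i _; rewrite lift0 subSS binS mulnDl addnC.
rewrite big_split/= !bin0 !mul1n -!addnA; congr (_ + _)%N.
rewrite [RHS]addnC; congr (_ + _)%N.
rewrite [in RHS]big_ord_recr/= bin_small// mul0n addn0.
by apply: eq_bigr => i _; rewrite /bump/= add1n subSS.
Qed.

Lemma factorial_double a : (a.*2)`! = (2 ^ a * a`! * chi2_moment 1 a)%N.
Proof.
elim: a => [|a ih]; first by rewrite chi2_moment0.
by rewrite doubleS !factS ih chi2_momentS expnS -doubleS -mul2n; ring.
Qed.

(** In the binomial expansion of a moment of order [2p] only the even exponents
    contribute; this turns their coefficients into those of an expansion of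
    order [p]. *)
Lemma bin_double p a : (a <= p)%N ->
  ('C(p.*2, a.*2) * (chi2_moment 1 (p - a) * chi2_moment 1 a) =
   'C(p, a) * chi2_moment 1 p)%N.
Proof.
move=> ap; have ap2 : (a.*2 <= p.*2)%N by rewrite leq_double.
apply/eqP; rewrite -(@eqn_pmul2r (2 ^ p * (a`! * (p - a)`!))); last first.
  by rewrite !muln_gt0 expn_gt0 !fact_gt0.
apply/eqP; transitivity ((p.*2)`!).
  rewrite -(bin_fact ap2) -doubleB !factorial_double.
  have -> : (2 ^ p = 2 ^ (p - a) * 2 ^ a)%N by rewrite -expnD subnK.
  move: 'C(_, _) (chi2_moment _ (p - a)) (chi2_moment _ a) (2 ^ (p - a))%N
    (2 ^ a)%N a`! (p - a)`! => *; ring.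
rewrite factorial_double -(bin_fact ap).
by move: 'C(_, _) (chi2_moment _ _) (2 ^ p)%N a`! (p - a)`! => *; ring.
Qed.

Section gauss_moment.
Variable R : realType.

(** The [q]-th moment of the centred normal law of variance [v]. *)
Definition gauss_moment (v : R) (q : nat) : R :=
  if odd q then 0 else (chi2_moment 1 q./2)%:R * v ^+ q./2.

Lemma gauss_moment_double v p :
  gauss_moment v p.*2 = (chi2_moment 1 p)%:R * v ^+ p.
Proof. by rewrite /gauss_moment odd_double doubleK. Qed.

Lemma gauss_moment0 v : gauss_moment v 0 = 1.
Proof. by rewrite /gauss_moment /= chi2_moment0 expr0 mulr1. Qed.

Lemma gauss_momentSS v q :
  gauss_moment v q.+2 = q.+1%:R * v * gauss_moment v q.
Proof.
rewrite /gauss_moment /= negbK; case: ifPn => oq; first by rewrite mulr0.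
rewrite chi2_momentS exprS natrM -mul2n mul2n even_halfK// addSn add0n.
by ring.
Qed.

Lemma sum_even (F : nat -> R) p : (forall b, odd b -> F b = 0) ->
  \sum_(b < p.*2.+1) F b = \sum_(a < p.+1) F a.*2.
Proof.
move=> F0; elim: p => [|p ih]; first by rewrite !big_ord_recl !big_ord0.
rewrite doubleS big_ord_recr big_ord_recr/= ih [in RHS]big_ord_recr/=.
by rewrite (F0 p.*2.+1) ?addr0//= odd_double.
Qed.

(** Independent centred normal variables add up to a centred normal variable
    whose variance is the sum of the variances; this is the statement at the
    level of moments. *)
Lemma gauss_momentD u v q : gauss_moment (u + v) q =
  \sum_(b < q.+1) (gauss_moment u (q - b) * gauss_moment v b) *+ 'C(q, b).
Proof.
have [oq|/even_halfK qE] := boolP (odd q).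
  rewrite [LHS]/gauss_moment oq big1// => b _; rewrite /gauss_moment.
  have : odd (q - b) || odd b by rewrite (oddB (leq_ord b)) oq; case: (odd b).
  by case/orP => ->; rewrite ?mul0r ?mulr0 mul0rn.
rewrite -qE; set p := q./2.
rewrite (@sum_even (fun b =>
    (gauss_moment u (p.*2 - b) * gauss_moment v b) *+ 'C(p.*2, b))).
  rewrite gauss_moment_double exprDn mulr_sumr; apply: eq_bigr => a _.
  rewrite -doubleB !gauss_moment_double mulrACA -natrM.
  rewrite -mulrnAr -[_ *+ 'C(p, a)]mulr_natl -[RHS]mulr_natl !mulrA -!natrM.
  rewrite (bin_double (leq_ord a)) natrM [in RHS](mulrC _%:R).
  by rewrite [X in X * _ = _]mulrAC.
by move=> b ob; rewrite [gauss_moment v b]/gauss_moment ob mulr0 mul0rn.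
Qed.

End gauss_moment.

(** * Powers of sums of independent variables *)

Lemma Rintegral_prob_cst d (T : measurableType d) (R : realType)
  (P : probability T R) (r : R) : \int[P]_w r = r.
Proof.
rewrite Rintegral_cst// [X in fine X](_ : _ = 1%E) ?mulr1//.
exact: probability_setT.
Qed.

Section power_of_independent_sum.
Context d (T : measurableType d) (R : realType) (P : probability T R).
Variables (I : finType) (X : I -> {RV P >-> R}).
Hypothesis indepX : mutually_independent X.
Variable g : I -> R -> R.
Hypothesis mg : forall i, measurable_fun setT (g i).
Hypothesis ig : forall i q, P.-integrable setT (fun w => (g i (X i w) ^+ q)%:E).

Variable H : seq I -> nat -> R.
Hypothesis H0 : forall q, H [::] q = (q == 0%N)%:R.
Hypothesis HS : forall j s q, H (j :: s) q =
  \sum_(b < q.+1) (H s (q - b) * \int[P]_w (g j (X j w) ^+ b)) *+ 'C(q, b).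

(** The induction on [s] expands one summand at a time; the exponents [e] keep
    track of the powers of the variables outside [s] produced by the expansion,
    so that independence is only needed for products of powers. *)
Lemma power_independent_sum_prod s q e : uniq s ->
  (forall i, i \in s -> e i = 0%N) ->
  let f w := (\sum_(i <- s) g i (X i w)) ^+ q * \prod_i g i (X i w) ^+ e i in
  P.-integrable setT (EFin \o f) /\
  \int[P]_w f w = H s q * \prod_i \int[P]_w (g i (X i w) ^+ e i).
Proof.
elim: s q e => [|j s ih] q e.
  move=> _ _ /=; have [i1 i2] := independent_prod indepX
    (fun i => measurable_funX (e i) (mg i)) (fun i => ig i (e i)).
  rewrite H0; case: q => [|q] /=.
    rewrite mul1r -i2; split; last first.
      by apply: eq_Rintegral => w _; rewrite expr0 mul1r.
    by apply: eq_integrable i1 => // w _; rewrite /= expr0 mul1r.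
  split.
    apply: (eq_integrable _ (cst 0%:E)) => // [w _|]; last exact: integrable0.
    by rewrite /= big_nil expr0n mul0r.
  rewrite mul0r (@eq_Rintegral _ _ _ _ _ (cst 0)) => [|w _]; last first.
    by rewrite /= big_nil expr0n mul0r.
  by rewrite Rintegral_cst// mul0r.
move=> /= /andP[js us] e0.
have bigDj (F : I -> R) : \prod_i F i = F j * \prod_(i | i != j) F i.
  exact: bigD1.
pose e' b i := if i == j then b else e i.
have e'0 b i : i \in s -> e' b i = 0%N.
  move=> si; rewrite /e'; case: eqP => [ij|_]; first by rewrite -ij si in js.
  by rewrite e0// inE si orbT.
pose F b w := ((\sum_(i <- s) g i (X i w)) ^+ (q - b) *
  \prod_i g i (X i w) ^+ e' b i) *+ 'C(q, b).
have fE w : (\sum_(i <- j :: s) g i (X i w)) ^+ q * \prod_i g i (X i w) ^+ e i =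
    \sum_(b < q.+1) F b w.
  rewrite big_cons addrC exprDn mulr_suml; apply: eq_bigr => b _.
  rewrite /F mulrnAl -mulrA; congr ((_ * _) *+ _).
  rewrite !bigDj /e' eqxx e0 ?inE ?eqxx// mul1r; congr (_ * _).
  by apply: eq_bigr => i /negPf ->.
have iF b : P.-integrable setT (EFin \o F b).
  rewrite (_ : _ \o _ = fun w => (('C(q, b))%:R%:E *
      (((\sum_(i <- s) g i (X i w)) ^+ (q - b) *
        \prod_i g i (X i w) ^+ e' b i))%:E)%E).
    by apply: integrableZl => //; have [] := ih (q - b)%N (e' b) us (e'0 b).
  by apply/funext => w; rewrite /F /= -EFinM mulr_natl.
have intF b : \int[P]_w F b w =
    (H s (q - b) * \int[P]_w (g j (X j w) ^+ b)) *+ 'C(q, b) *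
    \prod_i \int[P]_w (g i (X i w) ^+ e i).
  have [i1 i2] := ih (q - b)%N (e' b) us (e'0 b).
  under eq_Rintegral do rewrite /F -mulr_natl.
  rewrite RintegralZl//= i2 mulr_natl mulrnAl; congr (_ *+ _).
  rewrite -mulrA; congr (_ * _).
  rewrite !bigDj /e' eqxx e0 ?inE ?eqxx//.
  under [X in _ = _ * (X * _)]eq_Rintegral do rewrite expr0.
  rewrite Rintegral_prob_cst mul1r; congr (_ * _).
  by apply: eq_bigr => i /negPf ->.
split.
  rewrite (_ : _ \o _ = fun w => (\sum_(b < q.+1) (F b w)%:E)%E).
    by apply: integrable_sum => // b _; exact: iF.
  by apply/funext => w; rewrite /= fE sumEFin.
under eq_Rintegral do rewrite fE.
rewrite HS mulr_suml; under [RHS]eq_bigr do rewrite -intF.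
rewrite /Rintegral; under eq_integral do rewrite -sumEFin.
rewrite integral_sum//; last by move=> b; exact: iF.
rewrite -[RHS]/(fine (EFin _)) -sumEFin; congr fine; apply: eq_bigr => b _.
by rewrite fineK//; apply: integrable_fin_num => //; exact: iF.
Qed.

(** The recursion [HS] is satisfied by the moments of the partial sums, hence
    it determines them: a closed form is verified by checking [HS] alone. *)
Lemma power_independent_sum s q : uniq s ->
  P.-integrable setT (fun w => ((\sum_(i <- s) g i (X i w)) ^+ q)%:E) /\
  \int[P]_w ((\sum_(i <- s) g i (X i w)) ^+ q) = H s q.
Proof.
move=> us; have [i1 i2] :=
  @power_independent_sum_prod s q (fun=> 0%N) us (fun _ _ => erefl).
have fE w : (\sum_(i <- s) g i (X i w)) ^+ q * \prod_i g i (X i w) ^+ 0 =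
    (\sum_(i <- s) g i (X i w)) ^+ q.
  by rewrite [X in _ * X]big1 ?mulr1// => i _; rewrite expr0.
split.
  by apply: eq_integrable i1 => // w _; rewrite /= fE.
under eq_Rintegral do rewrite -fE.
rewrite i2 big1 ?mulr1// => i _.
by rewrite (@eq_Rintegral _ _ _ _ _ (cst 1)) ?Rintegral_prob_cst.
Qed.

End power_of_independent_sum.

(** * Moments of a normal variable *)

Section integral_derivative.
Variable R : realType.
Local Notation mu := (@lebesgue_measure R).

(** The fundamental theorem of calculus on [[-n, n]], followed by dominated
    convergence. *)
Lemma Rintegral_derive_vanish (F f : R -> R) :
  continuous f -> (forall x, is_derive x (1 : R) F (f x)) ->
  mu.-integrable setT (EFin \o f) ->
  F n.+1%:R - F (- n.+1%:R) @[n --> \oo] --> (0 : R) ->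
  \int[mu]_x f x = 0.
Proof.
move=> cf dF fi F0.
pose I n : set R := `[(- n.+1%:R), n.+1%:R]%classic.
have FTC n : (\int[mu]_x (f x * \1_(I n) x)%:E = (F n.+1%:R - F (- n.+1%:R))%:E)%E.
  have -> : (\int[mu]_x (f x * \1_(I n) x)%:E = \int[mu]_(x in I n) (f x)%:E)%E.
    rewrite [RHS]integral_mkcond; apply: eq_integral => x _.
    by rewrite patchE indicE; case: ifP => _; rewrite ?mulr1 ?mulr0.
  have cF : continuous F.
    move=> x; apply: differentiable_continuous; apply/derivable1_diffP.
    exact: (@ex_derive _ _ _ _ _ _ _ (dF x)).
  rewrite (@continuous_FTC2 _ f F).
  - by rewrite EFinB.
  - by rewrite -subr_gt0 opprK addr_gt0.
  - exact: continuous_subspaceT.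
  - split.
    + by move=> x _; exact: (@ex_derive _ _ _ _ _ _ _ (dF x)).
    + exact/cvg_at_right_filter/cF.
    + exact/cvg_at_left_filter/cF.
  - by move=> x _; rewrite derive1E; exact: (@derive_val _ _ _ _ _ _ _ (dF x)).
have mf : measurable_fun setT f by exact: continuous_measurable_fun.
have [|||||_ _] := @dominated_convergence _ _ _ mu setT measurableT
  (fun n x => (f x * \1_(I n) x)%:E) (EFin \o f) (fun x => `|(f x)%:E|%E).
- move=> n; apply/measurable_EFinP/measurable_funM => //.
  by apply: measurable_indic; exact: measurable_itv.
- exact/measurable_EFinP.
- apply: aeW => x _; apply: cvg_near_cst.
  near=> n; rewrite indicE mem_set ?mulr1// /I /= in_itv/= -ler_norml.
  rewrite (le_trans (ltW (truncnS_gt _)))// ler_nat ltnS.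
  by near: n; exact: nbhs_infty_ge.
- exact: integrable_abse.
- apply: aeW => x n _ /=; rewrite lee_fin normrM ler_piMr// indicE.
  by case: (_ \in _); rewrite ?normr1 ?normr0.
under eq_fun do rewrite FTC.
move=> h; have e : (\int[mu]_x (f x)%:E = (0 : R)%:E)%E.
  apply: (cvg_unique _ h) => //; apply: cvg_EFin; [exact: nearW|exact: F0].
by rewrite /Rintegral e.
Unshelve. all: by end_near. Qed.

End integral_derivative.

Section normal_moments.
Variables (R : realType) (s : R).
Hypothesis s0 : 0 < s.
Local Notation mu := (@lebesgue_measure R).
Local Notation phi := (normal_pdf 0 s).

Let s_neq0 : s != 0. Proof. by rewrite gt_eqF. Qed.

Let phiE x : phi x = normal_peak s * expR (- (s ^+ 2 *+ 2)^-1 * x ^+ 2).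
Proof. by rewrite normal_pdfE// /normal_fun subr0 !mulNr [x ^+ 2 * _]mulrC. Qed.

(** Half of the exponent of the density absorbs any power of the variable; the
    other half is, up to a constant, a normal density of twice the variance. *)
Let normal_tail q : exists2 C : R, 0 <= C & forall x,
  `|x| ^+ q * phi x <= C * normal_pdf 0 (Num.sqrt 2 * s) x.
Proof.
pose c : R := (4 * s ^+ 2)^-1.
have c0 : 0 < c by rewrite invr_gt0 mulr_gt0// exprn_gt0.
pose B : R := 1 + (c ^-1) ^+ q.+1 * (q.+1)`!%:R.
have B0 : 0 <= B by rewrite addr_ge0// mulr_ge0// exprn_ge0// invr_ge0 ltW.
have bound x : `|x| ^+ q <= B * expR (c * x ^+ 2).
  have y0 : 0 <= c * x ^+ 2 by rewrite mulr_ge0 ?sqr_ge0// ltW.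
  have e1 : 1 <= expR (c * x ^+ 2) by rewrite -expR0 ler_expR.
  have e2 : (c * x ^+ 2) ^+ q.+1 <= (q.+1)`!%:R * expR (c * x ^+ 2).
    rewrite [leRHS]mulrC -ler_pdivrMr ?ltr0n ?fact_gt0//.
    by apply: le_trans (expR_ge1Dxn q y0); rewrite lerDr.
  have e3 : (x ^+ 2) ^+ q.+1 <= c^-1 ^+ q.+1 * (q.+1)`!%:R * expR (c * x ^+ 2).
    rewrite -{1}(mulKf (lt0r_neq0 c0) (x ^+ 2)) exprMn -mulrA.
    by rewrite ler_wpM2l// exprn_ge0// invr_ge0 ltW.
  have : `|x| ^+ q <= 1 + (x ^+ 2) ^+ q.+1.
    have [x1|x1] := leP `|x| 1.
      by rewrite (le_trans (exprn_ile1 _ _ _))// lerDl exprn_ge0// sqr_ge0.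
    rewrite -(real_normK (num_real x)) -exprM.
    rewrite (le_trans (ler_weXn2l (ltW x1) (_ : q <= 2 * q.+1)%N))//.
      by rewrite mul2n -addnn addSn ltnW// ltnS leq_addr.
    by rewrite lerDr.
  by move=> /le_trans; apply; rewrite mulrDl mul1r lerD.
have t0 : Num.sqrt 2 * s != 0 by rewrite mulf_neq0// gt_eqF// sqrtr_gt0.
exists (normal_peak s * B / normal_peak (Num.sqrt 2 * s)).
  by rewrite divr_ge0// ?mulr_ge0// normal_peak_ge0.
move=> x; rewrite (normal_pdfE _ t0) /normal_fun mulrA divfK; last first.
  by rewrite gt_eqF// normal_peak_gt0.
rewrite phiE mulrCA -mulrA ler_wpM2l ?normal_peak_ge0//.
have -> : - (s ^+ 2 *+ 2)^-1 * x ^+ 2 = - (c * x ^+ 2) - c * x ^+ 2.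
  by rewrite /c; field.
have -> : - (x - 0) ^+ 2 / ((Num.sqrt 2 * s) ^+ 2 *+ 2) = - (c * x ^+ 2).
  by rewrite /c exprMn sqr_sqrtr// subr0; field.
rewrite expRD mulrA ler_wpM2r ?expR_ge0//.
by rewrite expRN ler_pdivrMr ?expR_gt0.
Qed.

Lemma integrable_normal_power q :
  mu.-integrable setT (EFin \o (fun x => phi x * x ^+ q)).
Proof.
have [C C0 hC] := normal_tail q.
apply: (@le_integrable _ _ _ mu setT measurableT _
    (fun x => C%:E * (normal_pdf 0 (Num.sqrt 2 * s) x)%:E)%E).
- apply/measurable_EFinP/measurable_funM; first exact: measurable_normal_pdf.
  exact: exprn_measurable.
- move=> x _; rewrite /= lee_fin normrM normrX ger0_norm ?normal_pdf_ge0//.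
  by rewrite mulrC [leRHS]ger0_norm ?mulr_ge0 ?normal_pdf_ge0.
- by apply: integrableZl => //; exact: integrable_normal_pdf.
Qed.

Let integrable_scaled_power k q :
  mu.-integrable setT (EFin \o (fun x => k * (phi x * x ^+ q))).
Proof. exact: (integrableZl measurableT k (integrable_normal_power q)). Qed.

(** Integration by parts, in the form of an antiderivative. For [q = 0] the
    factor [q%:R] cancels the meaningless power [q.-1], so that the rule also
    says that the mean is zero. *)
Let normal_moment_rec q :
  \int[mu]_x (phi x * x ^+ q.+1) = s ^+ 2 * q%:R * \int[mu]_x (phi x * x ^+ q.-1).
Proof.
pose F x := - s ^+ 2 * (x ^+ q * phi x).
pose f x := phi x * x ^+ q.+1 - s ^+ 2 * q%:R * (phi x * x ^+ q.-1).
suff : \int[mu]_x f x = 0.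
  rewrite /f RintegralB//; last exact: integrable_normal_power.
  rewrite (RintegralZl _ measurableT (integrable_normal_power q.-1)).
  by move/eqP; rewrite subr_eq0 => /eqP.
have cphi : continuous phi by exact: continuous_normal_pdf.
apply: (@Rintegral_derive_vanish _ F).
- move=> x; apply: cvgB; first by apply: cvgM; [exact: cphi|exact: exprn_continuous].
  apply: cvgM; first exact: cvg_cst.
  by apply: cvgM; [exact: cphi|exact: exprn_continuous].
- move=> x; pose a := - (s ^+ 2 *+ 2)^-1.
  have dX n : is_derive x (1 : R) (fun y : R => y ^+ n) (n%:R * x ^+ n.-1).
    rewrite (_ : (fun y : R => y ^+ n) = (id : R -> R) ^+ n); last first.
      by apply/funext => y; rewrite exprfctE.
    by apply: is_derive_eq; rewrite /GRing.scale/= mulr1.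
  have d2 : is_derive x (1 : R) (fun y : R => a *: (y ^+ 2)) (a *: (2%:R * x ^+ 1)).
    exact: (is_deriveZ a (dX 2)).
  have dphi : is_derive x (1 : R) phi (- (s ^+ 2)^-1 * x * phi x).
    rewrite (_ : phi = normal_peak s \*:
      (expR \o (fun y : R => a *: (y ^+ 2)))); last first.
      by apply/funext => y; rewrite phiE.
    apply: is_derive_eq.
    by rewrite /= /a /GRing.scale/= expr1; field.
  rewrite (_ : F = (- s ^+ 2) \*: ((fun y : R => y ^+ q) * phi))//.
  apply: is_derive_eq.
  by rewrite /f /GRing.scale/= [x ^+ q.+1]exprS; field.
- exact: (integrableB measurableT (integrable_normal_power q.+1)
    (integrable_scaled_power (s ^+ 2 * q%:R) q.-1)).
- have [C C0 hC] := normal_tail q.+1.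
  pose K : R := C * normal_peak (Num.sqrt 2 * s).
  have t0 : Num.sqrt 2 * s != 0 by rewrite mulf_neq0// gt_eqF// sqrtr_gt0.
  (* One more power of the variable is bounded, so [F] decays like [1 / x]. *)
  have hF x : `|x| * `|F x| <= s ^+ 2 * K.
    rewrite /F normrM normrN [`|s ^+ 2|]ger0_norm ?sqr_ge0// mulrCA.
    rewrite ler_wpM2l ?sqr_ge0//.
    rewrite normrM normrX mulrA -exprS [`|phi x|]ger0_norm ?normal_pdf_ge0//.
    by rewrite (le_trans (hC x))// ler_wpM2l// normal_pdf_ub.
  have hn n : `|F n.+1%:R - F (- n.+1%:R)| <= s ^+ 2 * K *+ 2 * harmonic n.
    rewrite (le_trans (ler_normB _ _))// /harmonic ler_pdivlMr// mulrDl mulr2n.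
    have := hF n.+1%:R; have := hF (- n.+1%:R).
    by rewrite normrN normr_nat ![n.+1%:R * _]mulrC => h1 h2; exact: lerD.
  apply/cvgr0Pnorm_le => e e0.
  have /cvgr0Pnorm_le/(_ _ e0) : s ^+ 2 * K *+ 2 * harmonic n @[n --> \oo] --> (0 : R).
    rewrite -[X in _ --> X](mulr0 (s ^+ 2 * K *+ 2)).
    by apply: cvgM; [exact: cvg_cst|exact: cvg_harmonic].
  apply: filterS => n; apply: le_trans; rewrite (le_trans (hn n))//.
  exact: ler_norm.
Qed.

Lemma normal_moment q : \int[mu]_x (phi x * x ^+ q) = gauss_moment (s ^+ 2) q.
Proof.
suff : (\int[mu]_x (phi x * x ^+ q) = gauss_moment (s ^+ 2) q) /\
  (\int[mu]_x (phi x * x ^+ q.+1) = gauss_moment (s ^+ 2) q.+1) by case.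
elim: q => [|q [ih0 ih1]]; split => //.
- rewrite gauss_moment0 /Rintegral.
  by under eq_integral do rewrite expr0 mulr1; rewrite integral_normal_pdf.
- by rewrite normal_moment_rec mulr0 mul0r /gauss_moment.
- by rewrite normal_moment_rec /= ih0 gauss_momentSS [_ * q.+1%:R]mulrC.
Qed.

End normal_moments.

Section normal_random_variable.
Context d (T : measurableType d) (R : realType) (P : probability T R).
Variables (X : {RV P >-> R}) (s : R).
Hypothesis s0 : 0 < s.
Hypothesis lawX : forall B, measurable B -> distribution P X B = normal_prob 0 s B.
Local Notation mu := (@lebesgue_measure R).
Local Notation phi := (normal_pdf 0 s).

Let ge0_expectation_normal (f : R -> R) :
  measurable_fun setT f -> (forall y, 0 <= f y) ->
  (\int[P]_w (f (X w))%:E = \int[mu]_x (phi x * f x)%:E)%E.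
Proof.
move=> mf f0; transitivity (\int[P]_w (cst 1 w * f (X w))%:E)%E.
  by apply: eq_integral => w _; rewrite mul1r.
apply: integral_weighted_ge0 => //; first exact: (measurable_funP X).
  exact: measurable_normal_pdf.
  by move=> y; exact: normal_pdf_ge0.
move=> B mB.
have -> : (\int[P]_w (cst 1 w * \1_B (X w))%:E = P (X @^-1` B))%E.
  under eq_integral do rewrite mul1r.
  rewrite (_ : (fun w => _) = EFin \o \1_(X @^-1` B))//.
  by rewrite integral_indic ?setIT//; exact: measurable_funPTI.
rewrite -[LHS]/(distribution P X B) lawX// /normal_prob [LHS]integral_mkcond.
by apply: eq_integral => x _; rewrite patchE indicE; case: ifP => _; rewrite ?mulr1 ?mulr0.
Qed.

Let expectation_normal (f : R -> R) : measurable_fun setT f ->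
  (\int[P]_w (f (X w))%:E = \int[mu]_x (phi x * f x)%:E)%E.
Proof.
move=> mf; rewrite [LHS]integralE [RHS]integralE.
congr (_ - _)%E.
  transitivity (\int[P]_w (f^\+ (X w))%:E)%E.
    by apply: eq_integral => w _; rewrite funeposE -EFin_max.
  rewrite ge0_expectation_normal//; last exact: measurable_funrpos.
  apply: eq_integral => x _; rewrite funeposE -EFin_max /funrpos.
  by rewrite maxr_pMr ?normal_pdf_ge0// mulr0.
transitivity (\int[P]_w (f^\- (X w))%:E)%E.
  by apply: eq_integral => w _; rewrite funenegE -EFinN -EFin_max.
rewrite ge0_expectation_normal//; last exact: measurable_funrneg.
apply: eq_integral => x _; rewrite funenegE -EFinN -EFin_max /funrneg.
by rewrite maxr_pMr ?normal_pdf_ge0// mulr0 mulrN.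
Qed.

Lemma normal_power q : P.-integrable setT (fun w => (X w ^+ q)%:E) /\
  \int[P]_w (X w ^+ q) = gauss_moment (s ^+ 2) q.
Proof.
have mX : measurable_fun setT (fun x : R => x ^+ q) by exact: exprn_measurable.
split; last first.
  by rewrite /Rintegral (expectation_normal mX) -[LHS]/(Rintegral _ _ _) normal_moment.
apply/integrableP; split.
  by apply/measurable_EFinP; exact: (measurableT_comp mX).
rewrite (ge0_expectation_normal (f := fun x => `|x ^+ q|)) //; last first.
  exact: measurableT_comp.
have /integrableP[_] := integrable_normal_power s0 q.
by under eq_integral do rewrite /= normrM ger0_norm ?normal_pdf_ge0//.
Qed.

End normal_random_variable.

(** * Linear and quadratic forms in independent normal variables *)

Section gaussian_family.
Context d (T : measurableType d) (R : realType) (P : probability T R).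
Variables (I : finType) (X : I -> {RV P >-> R}) (s : R).
Hypothesis indepX : mutually_independent X.
Hypothesis s0 : 0 < s.
Hypothesis lawX : forall i B, measurable B ->
  distribution P (X i) B = normal_prob 0 s B.

Let integral_Rintegral (f : T -> R) (r : R) :
  P.-integrable setT (fun w => (f w)%:E) /\ \int[P]_w f w = r ->
  (\int[P]_w (f w)%:E = r%:E)%E.
Proof. by move=> [fi <-]; rewrite fineK//; exact: integrable_fin_num. Qed.

Lemma linear_form_moment (a : I -> R) p :
  (\int[P]_w ((\sum_i a i * X i w) ^+ p.*2)%:E =
   ((chi2_moment 1 p)%:R * (s ^+ 2 * \sum_i a i ^+ 2) ^+ p)%:E)%E.
Proof.
rewrite -gauss_moment_double; apply: integral_Rintegral.
have mg i : measurable_fun setT (fun x : R => a i * x) by exact: measurable_funM.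
have gE i q w : (a i * X i w) ^+ q = a i ^+ q * X i w ^+ q by rewrite exprMn.
have ig i q : P.-integrable setT (fun w => ((a i * X i w) ^+ q)%:E).
  have [iX _] := normal_power s0 (lawX i) q.
  apply: eq_integrable (integrableZl measurableT (a i ^+ q) iX) => // w _.
  by rewrite /= gE EFinM.
have intg i q : \int[P]_w ((a i * X i w) ^+ q) = gauss_moment (s ^+ 2 * a i ^+ 2) q.
  have [iX iE] := normal_power s0 (lawX i) q.
  under eq_Rintegral do rewrite gE.
  rewrite RintegralZl// iE /gauss_moment.
  have [_|/even_halfK {1}<-] := boolP (odd q).
    by rewrite mulr0.
  by rewrite -mul2n exprM [in RHS]exprMn mulrCA [X in _ * X]mulrC.
apply: (power_independent_sum indepX mg ig
  (H := fun r => gauss_moment (s ^+ 2 * \sum_(i <- r) a i ^+ 2))).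
- move=> q; rewrite big_nil mulr0 /gauss_moment; case: q => [|[|q]]/=.
  + by rewrite chi2_moment0 expr0 mulr1.
  + by [].
  + by rewrite negbK exprS mul0r mulr0; case: ifP.
- move=> j r q; rewrite big_cons addrC mulrDr gauss_momentD.
  by apply: eq_bigr => b _; rewrite intg.
- exact: index_enum_uniq.
Qed.

Lemma sum_squares_moment (r : seq I) p : uniq r ->
  (\int[P]_w ((\sum_(i <- r) X i w ^+ 2) ^+ p)%:E =
   ((chi2_moment (size r) p)%:R * s ^+ 2 ^+ p)%:E)%E.
Proof.
move=> ur; apply: integral_Rintegral.
have mg (i : I) : measurable_fun setT (fun x : R => x ^+ 2) by exact: exprn_measurable.
have gE i q w : (X i w ^+ 2) ^+ q = X i w ^+ q.*2 by rewrite -exprM mul2n.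
have ig i q : P.-integrable setT (fun w => ((X i w ^+ 2) ^+ q)%:E).
  have [iX _] := normal_power s0 (lawX i) q.*2.
  by apply: eq_integrable iX => // w _; rewrite gE.
have intg i q : \int[P]_w ((X i w ^+ 2) ^+ q) = (chi2_moment 1 q)%:R * s ^+ 2 ^+ q.
  have [iX iE] := normal_power s0 (lawX i) q.*2.
  by under eq_Rintegral do rewrite gE; rewrite iE gauss_moment_double.
apply: (power_independent_sum indepX mg ig
  (H := fun r q => (chi2_moment (size r) q)%:R * s ^+ 2 ^+ q)) => //.
- move=> [|q]; first by rewrite chi2_moment0 expr0 mulr1.
  by rewrite /chi2_moment big_ord_recl /= mul0n mul0r.
- move=> j u q; rewrite /= -[(size u).+1]addn1 chi2_momentD natr_sum mulr_suml.
  apply: eq_bigr => b _; rewrite intg -[RHS]mulr_natl [in RHS]mulrACA.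
  rewrite -exprD subnK ?leq_ord//.
  by rewrite !natrM !mulrA.
Qed.

End gaussian_family.

(** * Moments of the image of a random sparse vector *)

(** From the identity of Lagrange. *)
Lemma cauchy_schwarz_sum (R : realDomainType) (I : finType) (Q : pred I) (a b : I -> R) :
  (\sum_(i | Q i) a i * b i) ^+ 2 <=
  (\sum_(i | Q i) a i ^+ 2) * (\sum_(i | Q i) b i ^+ 2).
Proof.
rewrite -subr_ge0 -(pmulrn_lge0 _ (ltn0Sn 1)).
rewrite (_ : _ *+ 2 = \sum_(i | Q i) \sum_(j | Q j) (a i * b j - a j * b i) ^+ 2).
  by apply: sumr_ge0 => i _; apply: sumr_ge0 => j _; exact: sqr_ge0.
have -> : \sum_(i | Q i) \sum_(j | Q j) (a i * b j - a j * b i) ^+ 2 =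
    \sum_(i | Q i) \sum_(j | Q j) (a i ^+ 2 * b j ^+ 2) +
    \sum_(i | Q i) \sum_(j | Q j) (b i ^+ 2 * a j ^+ 2) -
    (\sum_(i | Q i) \sum_(j | Q j) ((a i * b i) * (a j * b j))) *+ 2.
  rewrite -sumrMnl -big_split -sumrB/=; apply: eq_bigr => i _.
  rewrite -sumrMnl -big_split -sumrB/=; apply: eq_bigr => j _; ring.
rewrite -!big_distrlr/=; ring.
Qed.

Section moment_method.
Context d (T : measurableType d) (R : realType) (P : probability T R).
Variables (n N : nat) (X : 'I_n * 'I_N -> {RV P >-> R}) (s : R).
Hypothesis indepX : mutually_independent X.
Hypothesis s0 : 0 < s.
Hypothesis lawX : forall i B, measurable B ->
  distribution P (X i) B = normal_prob 0 s B.
Variables (r0 : 'I_n) (c0 : 'I_N) (p : nat).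
Local Open Scope ereal_scope.

Let entry_moment : R := ((chi2_moment 1 p)%:R * (s ^+ 2) ^+ p)%R.

Let entry_moment_gt0 : (0 < entry_moment)%R.
Proof. by rewrite mulr_gt0 ?exprn_gt0// chi2_moment_gt0. Qed.

Let sqr_double (x : R) : (x ^+ p.*2 = (x ^+ 2) ^+ p)%R.
Proof. by rewrite -mul2n exprM. Qed.

Let double_ge0 (x : R) : (0 <= x ^+ p.*2)%R.
Proof. by rewrite sqr_double exprn_ge0// sqr_ge0. Qed.

Let tonelli (f : T -> T -> R) :
  measurable_fun setT (fun x : T * T => f x.1 x.2) -> (forall w v, 0 <= f w v)%R ->
  \int[P]_w \int[P]_v (f w v)%:E = \int[P]_v \int[P]_w (f w v)%:E.
Proof.
move=> mf f0; apply: (@fubini_tonelli _ _ _ _ _ P P (fun x => (f x.1 x.2)%:E)).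
  exact/measurable_EFinP.
by move=> x; rewrite lee_fin.
Qed.

Let sum_pair (F : 'I_n * 'I_N -> R) :
  (\sum_ij F ij = \sum_i \sum_j F (i, j))%R.
Proof. by rewrite pair_bigA; apply: eq_bigr => -[]. Qed.

Let mX1 i : measurable_fun setT (fun x : T * T => X i x.1).
Proof. by apply: measurableT_comp => //; exact: measurable_fst. Qed.
Let mX2 i : measurable_fun setT (fun x : T * T => X i x.2).
Proof. by apply: measurableT_comp => //; exact: measurable_snd. Qed.

(** For a fixed vector [z], the moments of the norm of [A z] are those of a
    rescaled chi-squared variable. To see this, [|A z|^2p] is written, up to a
    constant, as the [2p]-th moment of the linear form [<A z, y>] in an
    independent copy [y] of a column, and the two integrals are exchanged:
    what remains is a linear form in all the entries of [A]. *)
Lemma image_norm_moment (z : 'I_N -> R) :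
  \int[P]_w ((\sum_i (\sum_j X (i, j) w * z j) ^+ 2) ^+ p)%R%:E =
  ((s ^+ 2 * \sum_j z j ^+ 2) ^+ p * (chi2_moment n p)%:R)%R%:E.
Proof.
pose y w i := (\sum_j X (i, j) w * z j)%R.
have my i : measurable_fun setT (fun x : T * T => y x.1 i).
  by apply: measurable_sum => j; apply: measurable_funM => //; exact: mX1.
pose f w v := ((\sum_i y w i * X (i, c0) v) ^+ p.*2)%R.
have mf : measurable_fun setT (fun x : T * T => f x.1 x.2).
  apply: measurable_funX; apply: measurable_sum => i.
  by apply: measurable_funM => //; exact: mX2.
have fv w : \int[P]_v (f w v)%:E = (entry_moment * (\sum_i y w i ^+ 2) ^+ p)%R%:E.
  pose a (ij : 'I_n * 'I_N) := if ij.2 == c0 then y w ij.1 else 0%R.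
  have aE (F : R -> 'I_n * 'I_N -> R) : (forall ij, F 0 ij = 0)%R ->
      (\sum_ij F (a ij) ij = \sum_i F (y w i) (i, c0))%R.
    move=> F0; rewrite sum_pair/=.
    apply: eq_bigr => i _; rewrite (bigD1 c0)//= big1 ?addr0 /a/= ?eqxx//.
    by move=> j /negPf ->.
  have -> : \int[P]_v (f w v)%:E = \int[P]_v ((\sum_ij a ij * X ij v) ^+ p.*2)%:E.
    apply: eq_integral => v _; congr (_ ^+ _)%:E.
    by rewrite (aE (fun b ij => b * X ij v)%R)// => ij; rewrite mul0r.
  rewrite (linear_form_moment indepX s0 lawX) (aE (fun b _ => b ^+ 2)%R).
    by rewrite exprMn mulrA.
  by move=> _; rewrite expr0n.
have fw v : \int[P]_w (f w v)%:E =
    (entry_moment * (\sum_j z j ^+ 2) ^+ p *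
     (\sum_(ij <- [seq (i, c0) | i <- enum 'I_n]) X ij v ^+ 2) ^+ p)%R%:E.
  have -> : \int[P]_w (f w v)%:E =
      \int[P]_w ((\sum_ij (X (ij.1, c0) v * z ij.2) * X ij w) ^+ p.*2)%:E.
    apply: eq_integral => w _; congr (_ ^+ _)%:E.
    rewrite sum_pair/=.
    apply: eq_bigr => i _; rewrite /y mulr_suml; apply: eq_bigr => j _; ring.
  rewrite (linear_form_moment indepX s0 lawX); congr (_%:E).
  have -> : (\sum_ij (X (ij.1, c0) v * z ij.2) ^+ 2 =
      (\sum_j z j ^+ 2) * \sum_i X (i, c0) v ^+ 2)%R.
    rewrite sum_pair/= mulrC big_distrlr/=; apply: eq_bigr => i _.
    by apply: eq_bigr => j _; rewrite exprMn.
  by rewrite big_map big_enum/= /entry_moment !exprMn !mulrA.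
have ur : uniq [seq (i, c0) | i <- enum 'I_n].
  by rewrite map_inj_uniq ?enum_uniq// => i j [].
have E : entry_moment%:E * \int[P]_w ((\sum_i (y w i) ^+ 2) ^+ p)%R%:E =
    (entry_moment * (\sum_j z j ^+ 2) ^+ p * ((chi2_moment n p)%:R * s ^+ 2 ^+ p))%R%:E.
  rewrite -ge0_integralZl_EFin//; last 3 first.
  - by move=> w _; rewrite lee_fin exprn_ge0// sumr_ge0// => i _; exact: sqr_ge0.
  - apply/measurable_EFinP/measurable_funX/measurable_sum => i.
    apply/measurable_funX/measurable_sum => j.
    by apply: measurable_funM.
  - exact: ltW.
  under eq_integral do rewrite -EFinM -fv.
  rewrite tonelli//; last by move=> w v; exact: double_ge0.
  under eq_integral do rewrite fw EFinM.
  rewrite ge0_integralZl_EFin//; last 3 first.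
  - by move=> w _; rewrite lee_fin exprn_ge0// sumr_ge0// => i _; exact: sqr_ge0.
  - apply/measurable_EFinP/measurable_funX/measurable_sum => i.
    exact: measurable_funX.
  - apply: mulr_ge0; first exact: ltW.
    by apply: exprn_ge0; apply: sumr_ge0 => j _; exact: sqr_ge0.
  by rewrite (sum_squares_moment indepX s0 lawX)// size_map size_enum_ord -EFinM.
move: E; rewrite (_ : (_ * _ * _)%R = entry_moment * ((s ^+ 2 * \sum_j z j ^+ 2) ^+ p *
  (chi2_moment n p)%:R))%R; last by rewrite (exprMn p (s ^+ 2)%R); ring.
move/(congr1 (mule (entry_moment^-1)%R%:E)); rewrite muleA -!EFinM.
by rewrite mulKf ?mulVf ?gt_eqF// mul1e.
Qed.

(** The random vector supported on [S] is read off the row [r0] of an independent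
    copy of the matrix, so the same probability space provides it. *)
Let Q (S : {set 'I_N}) w v : R :=
  (\sum_i (\sum_(j in S) X (i, j) w * X (r0, j) v) ^+ 2)%R.

Definition sparse_moment (S : {set 'I_N}) w := \int[P]_v (Q S w v ^+ p)%R%:E.

Let Q_ge0 S w v : (0 <= Q S w v)%R.
Proof. by apply: sumr_ge0 => i _; exact: sqr_ge0. Qed.

Let mQ S : measurable_fun setT (fun x : T * T => Q S x.1 x.2 ^+ p)%R.
Proof.
apply/measurable_funX/measurable_sum => i; apply/measurable_funX.
under eq_fun do rewrite -big_enum/=.
by apply: measurable_sum => j; apply: measurable_funM; [exact: mX1|exact: mX2].
Qed.

Let mQ2 S w : measurable_fun setT (fun v => Q S w v ^+ p)%R.
Proof.
apply/measurable_funX/measurable_sum => i; apply/measurable_funX.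
under eq_fun do rewrite -big_enum/=.
by apply: measurable_sum => j; apply: measurable_funM.
Qed.

Lemma measurable_sparse_moment S : measurable_fun setT (sparse_moment S).
Proof.
apply: (@measurable_fun_fubini_tonelli_F _ _ _ _ _ P (fun x => (Q S x.1 x.2 ^+ p)%R%:E)).
  exact/measurable_EFinP.
by move=> x; rewrite lee_fin exprn_ge0.
Qed.

Lemma sparse_moment_ge0 S w : 0 <= sparse_moment S w.
Proof. by apply: integral_ge0 => v _; rewrite lee_fin exprn_ge0. Qed.

Lemma expectation_sparse_moment S :
  \int[P]_w sparse_moment S w =
  ((s ^+ 2) ^+ p * (chi2_moment n p)%:R * ((chi2_moment #|S| p)%:R * (s ^+ 2) ^+ p))%R%:E.
Proof.
rewrite tonelli//; last by move=> w v; exact: exprn_ge0.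
have Qv v : \int[P]_w (Q S w v ^+ p)%R%:E = ((s ^+ 2) ^+ p * (chi2_moment n p)%:R *
    (\sum_(ij <- [seq (r0, j) | j <- enum S]) X ij v ^+ 2) ^+ p)%R%:E.
  pose z j := if j \in S then X (r0, j) v else 0%R.
  have zE w i : (\sum_(j in S) X (i, j) w * X (r0, j) v = \sum_j X (i, j) w * z j)%R.
    by rewrite big_mkcond; apply: eq_bigr => j _; rewrite /z; case: ifP; rewrite ?mulr0.
  have -> : (\sum_(ij <- [seq (r0, j) | j <- enum S]) X ij v ^+ 2 = \sum_j z j ^+ 2)%R.
    rewrite big_map big_enum/= big_mkcond; apply: eq_bigr => j _.
    by rewrite /z; case: ifP; rewrite ?expr0n.
  under eq_integral => w _.
    rewrite /Q; under eq_bigr do rewrite zE.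
    over.
  by rewrite image_norm_moment (exprMn p (s ^+ 2)%R) mulrAC.
under eq_integral do rewrite Qv EFinM.
rewrite ge0_integralZl_EFin//; last 3 first.
- by move=> w _; rewrite lee_fin exprn_ge0// sumr_ge0// => i _; exact: sqr_ge0.
- apply/measurable_EFinP/measurable_funX/measurable_sum => i.
  exact: measurable_funX.
- by apply: mulr_ge0; rewrite // exprn_ge0// sqr_ge0.
rewrite (sum_squares_moment indepX s0 lawX); first by rewrite size_map -cardE -EFinM.
by rewrite map_inj_uniq ?enum_uniq// => i j [].
Qed.

(** With [u] the image of [x], the linear form [<u, A z>] is bounded by
    [|u| |A z|]. It is a normal variable in [z], whose variance is proportional
    to the squared norm of [A^T u] restricted to [S]; this norm is at least
    [lambda |u|^2] because its product with [|x|^2] dominates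
    [<A^T u, x>^2 = |u|^4]. *)
Lemma sparse_moment_lower (S : {set 'I_N}) w (x : 'I_N -> R) (lambda : R) :
  (0 < lambda)%R -> (forall j, j \notin S -> x j = 0%R) ->
  (0 < \sum_j x j ^+ 2)%R ->
  (lambda * \sum_j x j ^+ 2 <= \sum_i (\sum_j X (i, j) w * x j) ^+ 2)%R ->
  (entry_moment * lambda ^+ p)%R%:E <= sparse_moment S w.
Proof.
move=> l0 xS x0 lx.
pose y i := (\sum_j X (i, j) w * x j)%R; pose Y := (\sum_i y i ^+ 2)%R.
have Y0 : (0 < Y)%R by apply: lt_le_trans lx; rewrite mulr_gt0.
pose a j := if j \in S then (\sum_i y i * X (i, j) w)%R else 0%R.
have yax : (Y = \sum_j a j * x j)%R.
  transitivity (\sum_j (\sum_i y i * X (i, j) w) * x j)%R.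
    rewrite /Y; under [RHS]eq_bigr do rewrite mulr_suml.
    rewrite exchange_big; apply: eq_bigr => i _.
    rewrite expr2 [in X in (_ * X)%R]/y mulr_sumr; apply: eq_bigr => j _; ring.
  apply: eq_bigr => j _; rewrite /a; case: ifPn => // jS.
  by rewrite xS// !mulr0.
have a2 : (lambda * Y <= \sum_j a j ^+ 2)%R.
  rewrite -(ler_pM2r x0); apply: le_trans (_ : Y ^+ 2 <= _)%R.
    by rewrite mulrAC expr2 ler_wpM2r// ltW.
  by rewrite {1}yax; exact: cauchy_schwarz_sum.
have Qa v : ((\sum_j a j * X (r0, j) v) ^+ p.*2 <= Y ^+ p * Q S w v ^+ p)%R.
  have YQ0 : (0 <= Y * Q S w v)%R by rewrite mulr_ge0// ltW.
  rewrite sqr_double -exprMn lerXn2r ?nnegrE ?sqr_ge0//.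
  have -> : (\sum_j a j * X (r0, j) v =
      \sum_i y i * \sum_(j in S) X (i, j) w * X (r0, j) v)%R.
    under [RHS]eq_bigr do rewrite mulr_sumr.
    rewrite [RHS]exchange_big/= [RHS]big_mkcond; apply: eq_bigr => j _.
    rewrite /a; case: ifP; rewrite ?mul0r// mulr_suml => _.
    by apply: eq_bigr => i _; rewrite mulrA.
  exact: cauchy_schwarz_sum.
have Ya : \int[P]_v ((\sum_j a j * X (r0, j) v) ^+ p.*2)%R%:E =
    (entry_moment * (\sum_j a j ^+ 2) ^+ p)%R%:E.
  pose b (ij : 'I_n * 'I_N) := if ij.1 == r0 then a ij.2 else 0%R.
  have bE (F : R -> 'I_n * 'I_N -> R) : (forall ij, F 0 ij = 0)%R ->
      (\sum_ij F (b ij) ij = \sum_j F (a j) (r0, j))%R.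
    move=> F0; rewrite sum_pair (bigD1 r0)//= [X in (_ + X)%R]big1 ?addr0.
      by apply: eq_bigr => j _; rewrite /b/= eqxx.
    by move=> i /negPf ir; rewrite big1// => j _; rewrite /b/= ir.
  transitivity (\int[P]_v ((\sum_ij b ij * X ij v) ^+ p.*2)%:E).
    apply: eq_integral => v _; congr (_ ^+ _)%:E.
    by rewrite (bE (fun c ij => c * X ij v)%R)// => ij; rewrite mul0r.
  rewrite (linear_form_moment indepX s0 lawX) (bE (fun c _ => c ^+ 2)%R).
    by rewrite (exprMn p (s ^+ 2)%R) mulrA.
  by move=> _; rewrite expr0n.
have Yp : (0 < Y ^+ p)%R by rewrite exprn_gt0.
rewrite -(@lee_pmul2l _ (Y ^+ p)%:E)// ?lte_fin// -EFinM.
apply: (@le_trans _ _ (entry_moment * (\sum_j a j ^+ 2) ^+ p)%R%:E).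
  rewrite lee_fin mulrCA ler_wpM2l ?(ltW entry_moment_gt0)// -exprMn mulrC.
  have lY0 : (0 <= lambda * Y)%R by rewrite ltW// mulr_gt0.
  by rewrite lerXn2r ?nnegrE// (le_trans lY0).
rewrite -Ya /sparse_moment -ge0_integralZl_EFin//; last 3 first.
- by move=> v _; rewrite lee_fin exprn_ge0.
- by apply/measurable_EFinP; exact: mQ2.
- exact: ltW.
apply: ge0_le_integral => //.
- by move=> v _; rewrite lee_fin double_ge0.
- apply/measurable_EFinP/measurable_funX/measurable_sum => j.
  exact: measurable_funM.
- by apply: measurable_funeM; apply/measurable_EFinP; exact: mQ2.
- by move=> v _; rewrite -EFinM lee_fin.
Qed.

End moment_method.

(** * Measurability of the upper restricted isometry constant *)

Section measurability.
Variables (R : realType) (n N k : nat).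

Lemma sqr_norm2_mul (A : 'M[R]_(n, N)) (x : 'cV[R]_N) :
  norm2 (A *m x) ^+ 2 = \sum_i (\sum_j A i j * x j 0) ^+ 2.
Proof. by rewrite sqr_norm2; apply: eq_bigr => i _; rewrite mxE. Qed.

Let cvg_sumr (I : finType) (F : I -> nat -> R) (l : I -> R) :
  (forall i, F i m @[m --> \oo] --> l i) ->
  \sum_i F i m @[m --> \oo] --> \sum_i l i.
Proof. by move=> Fl; apply: (cvg_big (@add_continuous R^o)). Qed.

Let cvg_sqr (F : nat -> R) (l : R) :
  F m @[m --> \oo] --> l -> F m ^+ 2 @[m --> \oo] --> l ^+ 2.
Proof. by move=> Fl; exact: (cvgM Fl Fl). Qed.

(** By homogeneity it suffices to test integer vectors, which are countably
    many: rounding the multiples of [x] down to integers keeps its zeros. *)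
Lemma stretch_bound_int (A : 'M[R]_(n, N)) (mu : R) :
  (forall z : {ffun 'I_N -> int}, (#|[pred j | z j != 0]| <= k)%N ->
    \sum_i (\sum_j A i j * (z j)%:~R) ^+ 2 <= mu * \sum_j (z j)%:~R ^+ 2) ->
  forall x : 'cV[R]_N, chi k x -> norm2 (A *m x) ^+ 2 <= mu * norm2 x ^+ 2.
Proof.
move=> Az x xk; rewrite sqr_norm2_mul sqr_norm2.
pose z m : {ffun 'I_N -> int} := [ffun j => Num.floor (x j 0 * m.+1%:R)].
pose y m j : R := (z m j)%:~R / m.+1%:R.
have zk m : (#|[pred j | z m j != 0]| <= k)%N.
  apply: leq_trans xk; apply/subset_leq_card/fintype.subsetP => j; rewrite !inE.
  by apply: contraNneq => x0; rewrite ffunE x0 mul0r floor0.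
have yx j : y m j @[m --> \oo] --> x j 0.
  apply: (@squeeze_cvgr _ _ _ _ (fun m => x j 0 - harmonic m) (cst (x j 0))).
  - apply: nearW => m; rewrite /y /harmonic ffunE ler_pdivrMr// ler_pdivlMr//.
    rewrite floor_le andbT mulrBl mulVf// lerBlDr.
    by have := ltW (floorD1_gt (x j 0 * m.+1%:R)); rewrite intrD.
  - rewrite -[X in _ --> X]subr0; apply: cvgB; [exact: cvg_cst|exact: cvg_harmonic].
  - exact: cvg_cst.
have Ay m : \sum_i (\sum_j A i j * y m j) ^+ 2 <= mu * \sum_j y m j ^+ 2.
  have c0 : 0 < (m.+1%:R^-1 : R) ^+ 2 by rewrite exprn_gt0// invr_gt0.
  have := Az (z m) (zk m); rewrite -(ler_pM2r c0) -mulrA !mulr_suml.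
  rewrite (eq_bigr (fun i => (\sum_j A i j * y m j) ^+ 2)); last first.
    move=> i _; rewrite -exprMn mulr_suml; congr (_ ^+ 2).
    by apply: eq_bigr => j _; rewrite /y mulrA.
  by under [X in _ <= mu * X -> _]eq_bigr do rewrite -exprMn.
apply: (@ler_cvg_to _ \oo _ _ (fun m => \sum_i (\sum_j A i j * y m j) ^+ 2)
  (fun m => mu * \sum_j y m j ^+ 2)).
- apply: cvg_sumr => i; apply/cvg_sqr/cvg_sumr => j.
  by apply: cvgM; [exact: cvg_cst|exact: yx].
- by apply: cvgM; [exact: cvg_cst|apply: cvg_sumr => j; apply/cvg_sqr/yx].
- exact: nearW.
Qed.

Hypotheses (k0 : (0 < k)%N) (N0 : (0 < N)%N).

(** Since the supremum is attained, it is below [t + 1] only with a margin, and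
    bounds with a fixed margin pass to the limit of integer approximations. *)
Lemma upper_RIC_ltP (A : 'M[R]_(n, N)) (t : R) :
  upper_RIC k A < t <-> exists m : nat, forall z : {ffun 'I_N -> int},
    (#|[pred j | z j != 0]| <= k)%N ->
    \sum_i (\sum_j A i j * (z j)%:~R) ^+ 2 <=
      (t + 1 - m.+1%:R^-1) * \sum_j (z j)%:~R ^+ 2.
Proof.
have [supA ubA] := sparse_quotients_max A k0 N0; rewrite /upper_RIC.
split=> [|[m Am]].
  rewrite ltrBlDr => /ltr_add_invr[m mt]; exists m => z zk.
  pose x : 'cV[R]_N := \col_j (z j)%:~R.
  have -> : \sum_i (\sum_j A i j * (z j)%:~R) ^+ 2 = norm2 (A *m x) ^+ 2.
    rewrite sqr_norm2_mul; apply: eq_bigr => i _; congr (_ ^+ 2).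
    by apply: eq_bigr => j _; rewrite mxE.
  have -> : \sum_j ((z j)%:~R : R) ^+ 2 = norm2 x ^+ 2.
    by rewrite sqr_norm2; apply: eq_bigr => j _; rewrite mxE.
  have [->|x0] := eqVneq x 0.
    by rewrite mulmx0 !sqr_norm2 !big1 ?mulr0// => i _; rewrite mxE expr0n.
  have xx : 0 < norm2 x ^+ 2 by rewrite exprn_even_gt0//= norm2_neq0.
  rewrite -ler_pdivrMr//; apply: le_trans (ubA _ _) _.
    exists x => //; split=> //; apply: leq_trans zk.
    apply/subset_leq_card/fintype.subsetP => j; rewrite !inE mxE.
    by apply: contraNneq => ->.
  by rewrite lerBrDr ltW.
case: supA => x [xk x0] <-.
have xx : 0 < norm2 x ^+ 2 by rewrite exprn_even_gt0//= norm2_neq0.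
rewrite ltrBlDr ltr_pdivrMr//.
apply: le_lt_trans (stretch_bound_int Am xk) _.
by rewrite ltr_pM2r// ltrBlDr ltrDl invr_gt0.
Qed.

Lemma measurable_upper_RIC_lt d (T : measurableType d) (X : T -> 'M[R]_(n, N)) (t : R) :
  (forall i j, measurable_fun setT (fun w => X w i j)) ->
  measurable [set w | upper_RIC k (X w) < t].
Proof.
move=> mX; pose F m (z : {ffun 'I_N -> int}) := [set w |
  \sum_i (\sum_j X w i j * (z j)%:~R) ^+ 2 <=
  (t + 1 - m.+1%:R^-1) * \sum_j (z j)%:~R ^+ 2].
have -> : [set w | upper_RIC k (X w) < t] = \bigcup_m \bigcap_(q in [set: nat])
    (if (pickle_inv q : option {ffun 'I_N -> int}) is Some z then
       if (#|[pred j | z j != 0%R :> int]| <= k)%N then F m z else setT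
     else setT).
  apply/seteqP; split=> w /=.
    move/upper_RIC_ltP => [m Fm]; exists m => // q _.
    by case: pickle_inv => // z; case: ifP => // zk; exact: Fm.
  move=> [m _ Fm]; apply/upper_RIC_ltP; exists m => z zk.
  by have := Fm (pickle z) I; rewrite pickleK_inv zk.
apply: bigcupT_measurable => m; apply: bigcapT_measurable => q.
case: pickle_inv => // z; case: ifP => // _.
rewrite (_ : F m z = (fun w => \sum_i (\sum_j X w i j * (z j)%:~R) ^+ 2 <=
  (t + 1 - m.+1%:R^-1) * \sum_j (z j)%:~R ^+ 2) @^-1` [set true]); last by [].
rewrite -[X in measurable X]setTI; apply: measurable_fun_ler => //.
apply: measurable_sum => i; apply/measurable_funX/measurable_sum => j.
exact: measurable_funM.
Qed.

End measurability.

(** * The union bound *)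

Lemma exists_superset_card (I : finType) (Z : {set I}) k :
  (#|Z| <= k <= #|I|)%N -> exists2 S : {set I}, Z \subset S & #|S| = k.
Proof.
move=> /andP[Zk kI]; pose e := enum Z ++ enum (~: Z).
have ue : uniq e.
  rewrite cat_uniq !enum_uniq andbT/=; apply/hasPn => i.
  by rewrite !mem_enum inE.
have se : size e = #|I| by rewrite size_cat -!cardE cardsC.
exists [set i in take k e].
  apply/fintype.subsetP => i iZ; rewrite inE take_cat -cardE ltnNge Zk/=.
  by rewrite mem_cat mem_enum iZ.
by rewrite cardsE (card_uniqP (take_uniq _ ue)) size_take_min se; apply/minn_idPl.
Qed.

(** Markov's inequality for the sum of [sparse_moment] over all supports of
    size [k]; the binomial coefficient is the union bound over supports. *)
Lemma upper_RIC_tail (R : realType) d (T : measurableType d) (P : probability T R)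
    (k n N : nat) (X : 'I_n * 'I_N -> {RV P >-> R}) (lambda : R) (p : nat) :
  (0 < k)%N -> (k <= n)%N -> (n <= N)%N -> iid_gaussian_entries X -> 0 < lambda ->
  (1 - P [set w | (upper_RIC k (random_matrix X w) < lambda - 1)%R] <=
   ('C(N, k)%:R * (chi2_moment k p)%:R * (chi2_moment n p)%:R /
    ((chi2_moment 1 p)%:R * (n%:R * lambda) ^+ p))%:E)%E.
Proof.
move=> k0 kn nN [indepX lawX] l0.
have n0 : (0 < n)%N := leq_trans k0 kn; have N0 : (0 < N)%N := leq_trans n0 nN.
pose s : R := Num.sqrt n%:R^-1.
have nR0 : 0 < n%:R :> R by rewrite ltr0n.
have s0 : 0 < s by rewrite sqrtr_gt0 invr_gt0.
have s2 : s ^+ 2 = n%:R^-1 by rewrite sqr_sqrtr// invr_ge0 ltW.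
pose r0 : 'I_n := Ordinal n0.
have mXij i j : measurable_fun setT (fun w => random_matrix X w i j).
  by rewrite (_ : (fun w => _) = X (i, j))//; apply/funext => w; rewrite mxE.
pose G := [set w | upper_RIC k (random_matrix X w) < lambda - 1].
have mG : measurable G by exact: measurable_upper_RIC_lt.
rewrite -/G -probability_setC//.
pose Phi := sparse_moment X r0 p.
pose D : R := (chi2_moment 1 p)%:R * (s ^+ 2) ^+ p.
have chi1 : 0 < (chi2_moment 1 p)%:R :> R by exact: chi2_moment_gt0.
have D0 : 0 < D by rewrite mulr_gt0// s2 exprn_gt0// invr_gt0.
have Dl0 : 0 < D * lambda ^+ p by rewrite mulr_gt0// exprn_gt0.
pose draws := [set S : {set 'I_N} | #|S| == k]%SET.
have Phi0 S w : (0 <= Phi S w)%E := sparse_moment_ge0 _ _ _ _ _.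
have low w : (~` G) w ->
    ((D * lambda ^+ p)%:E <= \sum_(S in draws) Phi S w)%E.
  rewrite /G /= => /negP; rewrite -leNgt /upper_RIC lerBrDr subrK => lsup.
  have [[x [xk x0] xE] _] := sparse_quotients_max (random_matrix X w) k0 N0.
  have xx : 0 < norm2 x ^+ 2 by rewrite exprn_even_gt0//= norm2_neq0.
  have [|S suppS Sk] := @exists_superset_card _ [set j | x j 0 != 0%R]%SET k.
    by rewrite cardsE xk card_ord (leq_trans kn).
  rewrite (bigD1 S)/= ?inE ?Sk//; apply: (@le_trans _ _ (Phi S w)); last first.
    by rewrite leeDl// sume_ge0.
  apply: (@sparse_moment_lower _ _ _ _ _ _ X s indepX s0 lawX r0 p S w
    (fun j => x j 0)) => //.
  - move=> j jS; apply/eqP; apply: contraNT jS => xj0.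
    by apply: (fintype.subsetP suppS); rewrite inE.
  - by rewrite -sqr_norm2.
  - rewrite -sqr_norm2 -ler_pdivlMr//.
    rewrite -xE in lsup; apply: le_trans lsup _; rewrite sqr_norm2_mul.
    rewrite le_eqVlt; apply/orP; left; apply/eqP; congr (_ / _).
    by apply: eq_bigr => i _; congr (_ ^+ 2); apply: eq_bigr => j _; rewrite mxE.
have mPhi S : measurable_fun setT (Phi S) := measurable_sparse_moment _ _ _ _.
have : ((D * lambda ^+ p)%:E * P (~` G) <=
    \int[P]_w \sum_(S in draws) Phi S w)%E.
  have mGc : measurable (~` G) by exact: measurableC.
  rewrite -[~` G]setIT -integral_indic// -ge0_integralZl_EFin//; last 2 first.
  - by apply/measurable_EFinP; exact: measurable_indic.
  - exact: ltW.
  apply: ge0_le_integral => //.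
  - by move=> w _; rewrite mule_ge0// lee_fin// ltW.
  - by apply: measurable_funeM; apply/measurable_EFinP; exact: measurable_indic.
  - by under eq_fun do rewrite -big_enum/=; exact: emeasurable_sum.
  move=> w _; rewrite indicE; case: (boolP (w \in _)) => [|_].
    by rewrite inE mule1; exact: low.
  by rewrite mule0 sume_ge0.
have -> : (\int[P]_w \sum_(S in draws) Phi S w =
    ('C(N, k)%:R * ((s ^+ 2) ^+ p * (chi2_moment n p)%:R *
      ((chi2_moment k p)%:R * (s ^+ 2) ^+ p)))%:E)%E.
  under eq_integral do rewrite -big_enum/=.
  rewrite ge0_integral_sum//.
  rewrite big_enum/= (eq_bigr (fun=> ((s ^+ 2) ^+ p * (chi2_moment n p)%:R *
      ((chi2_moment k p)%:R * (s ^+ 2) ^+ p))%:E)); last first.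
    move=> S; rewrite inE => /eqP Sk.
    by rewrite (expectation_sparse_moment indepX s0 lawX r0 (Ordinal N0)) Sk.
  by rewrite sumEFin sumr_const card_draws card_ord ['C(N, k)%:R * _]mulr_natl.
move=> tail; rewrite -(@lee_pmul2l _ (D * lambda ^+ p)%:E)// ?lte_fin// -EFinM.
apply: le_trans tail _; rewrite lee_fin le_eqVlt; apply/orP; left; apply/eqP.
rewrite /D s2 exprMn exprVn.
by field; rewrite !gt_eqF ?exprn_gt0.
Qed.

(** * Logarithmic estimates *)

Section entropy.
Variable R : realType.
Implicit Types x y : R.

Definition xlnx x := x * ln x - x.

Lemma ln_le_sub1 x : 0 < x -> ln x <= x - 1.
Proof.
move=> x0; rewrite -{1}(subrKC 1 x) le_ln1Dx// ltrBrDr.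
by rewrite addrC subrr.
Qed.

(** Convexity of [x ln x - x], whose derivative is the logarithm. *)
Lemma xlnx_convex x y : 0 <= x -> 0 < y -> xlnx y - xlnx x <= (y - x) * ln y.
Proof.
move=> x0 y0; rewrite /xlnx; have [->|xn0] := eqVneq x 0.
  by rewrite mul0r !subr0 lerBlDr lerDl ltW.
have x1 : 0 < x by rewrite lt0r xn0.
have := ln_le_sub1 (divr_gt0 y0 x1); rewrite ln_div ?posrE// => h.
have := ler_wpM2l x0 h; rewrite !mulrBr mulr1 mulrCA divff// mulr1.
by lra.
Qed.

(** The logarithms of the factors are compared with half the integral of the
    logarithm, by convexity. *)
Lemma ln_chi2_moment_le m p : (0 < m)%N ->
  2 * ln (chi2_moment m p)%:R <= xlnx (m%:R + 2 * p%:R) - xlnx m%:R.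
Proof.
move=> m0; elim: p => [|p ih].
  by rewrite chi2_moment0 ln1 !mulr0 addr0 subrr.
have mp : 0 < m%:R + 2 * p%:R :> R by rewrite -natrM -natrD ltr0n addn_gt0 m0.
rewrite chi2_momentS natrM lnM ?posrE ?chi2_moment_gt0//; last first.
  by rewrite ltr0n addn_gt0 m0.
rewrite -mul2n natrD natrM.
have e : m%:R + 2 * p.+1%:R = m%:R + 2 * p%:R + 2 :> R by rewrite -natr1; ring.
have mp2 : 0 <= m%:R + 2 * p%:R + 2 :> R by rewrite addr_ge0// ltW.
by have := xlnx_convex mp2 mp; rewrite e; lra.
Qed.

(** The same comparison in the other direction is off by one step, and closing
    the gap from [2p - 1] to [2p] costs the logarithm on the left. *)
Lemma ln_chi2_moment1_ge p : (0 < p)%N ->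
  xlnx (2 * p%:R) - ln (2 * p%:R) <= 2 * ln (chi2_moment 1 p)%:R :> R.
Proof.
move=> p0; suff h : xlnx (2 * p%:R - 1) <= 2 * ln (chi2_moment 1 p)%:R.
  have p1 : 1 <= p%:R :> R by rewrite ler1n.
  have := @xlnx_convex (2 * p%:R - 1) (2 * p%:R); lra.
case: p p0 => // p _; elim: p => [|p ih].
  rewrite chi2_momentS chi2_moment0 /xlnx.
  by rewrite (_ : 2 * 1%:R - 1 = 1 :> R) ?ln1; lra.
have q0 : 0 < (1 + p.+1.*2)%:R :> R by rewrite ltr0n.
rewrite chi2_momentS natrM lnM ?posrE ?chi2_moment_gt0//.
have e : (1 + p.+1.*2)%:R = 2 * p.+2%:R - 1 :> R.
  by rewrite -mul2n natrD natrM -[p.+2%:R]natr1; ring.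
rewrite e in q0 *.
have p1 : 0 <= p.+1%:R :> R by [].
have := @xlnx_convex (2 * p.+1%:R - 1) (2 * p.+2%:R - 1).
have : 1 <= p.+1%:R :> R by rewrite ler1n.
move: q0 ih; rewrite -[p.+2%:R]natr1; lra.
Qed.

Lemma ln_factorial_ge k : xlnx k%:R <= ln k`!%:R :> R.
Proof.
elim: k => [|k ih]; first by rewrite /xlnx mul0r subr0 ln1.
rewrite factS natrM lnM ?posrE ?ltr0n ?fact_gt0//.
have := @xlnx_convex k%:R k.+1%:R; rewrite ler0n ltr0n => /(_ isT isT).
rewrite -[k.+1%:R in X in X -> _]natr1; move: ih; rewrite -[k.+1%:R]natr1; lra.
Qed.

Lemma ln_bin_le N k : (k <= N)%N -> (0 < k)%N ->
  ln 'C(N, k)%:R <= k%:R * ln (N%:R / k%:R) + k%:R :> R.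
Proof.
move=> kN k0; have N0 : (0 < N)%N := leq_trans k0 kN.
have : 'C(N, k)%:R * k`!%:R <= N%:R ^+ k :> R.
  rewrite -natrM -natrX ler_nat bin_ffact ffact_prod.
  rewrite (@leq_trans (\prod_(i < k) N))//.
    by apply: leq_prod => i _; exact: leq_subr.
  by rewrite prod_nat_const card_ord.
rewrite -ler_ln ?posrE ?mulr_gt0 ?exprn_gt0 ?ltr0n ?bin_gt0 ?fact_gt0//.
rewrite lnM ?posrE ?ltr0n ?bin_gt0 ?fact_gt0// lnXn ?ltr0n//.
rewrite ln_div ?posrE ?ltr0n// -mulr_natl.
have := ln_factorial_ge k; rewrite /xlnx; lra.
Qed.

(** The exponential rate of the moment bound, when [p] is [n lambda / 2]
    rounded down: this is close to the order at which the bound is smallest. *)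
Lemma ln_tail_le (k n N p : nat) (lambda : R) :
  (0 < k)%N -> (k <= n)%N -> (n <= N)%N -> 0 < lambda ->
  4 <= n%:R * lambda ->
  2 * p%:R <= n%:R * lambda -> n%:R * lambda - 2 <= 2 * p%:R ->
  2 * ln ('C(N, k)%:R * (chi2_moment k p)%:R * (chi2_moment n p)%:R /
    ((chi2_moment 1 p)%:R * (n%:R * lambda) ^+ p)) <=
  2 * (k%:R * ln (N%:R / k%:R)) + 3 * k%:R + k%:R * ln (n%:R / k%:R)
   + (k%:R + n%:R) * ln lambda + n%:R + 4 * n%:R / lambda - n%:R * lambda
   + 2 + ln (n%:R * lambda).
Proof.
move=> k0 kn nN l0 nl4 pl lp.
have n0 := leq_trans k0 kn.
have kR : 0 < k%:R :> R by rewrite ltr0n.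
have nR : 0 < n%:R :> R by rewrite ltr0n.
have NR : 0 < N%:R :> R by rewrite ltr0n (leq_trans n0).
have knR : k%:R <= n%:R :> R by rewrite ler_nat.
have nl0 : 0 < n%:R * lambda by rewrite mulr_gt0.
have t2 : n%:R * lambda <= 2 * (2 * p%:R) by lra.
have p0 : (0 < p)%N by rewrite -(ltr0n R); lra.
set t := 2 * p%:R in pl lp t2 *.
have t0 : 0 < t by rewrite /t mulr_gt0// ltr0n.
have C0 : 0 < 'C(N, k)%:R :> R by rewrite ltr0n bin_gt0 (leq_trans kn).
rewrite !ln_div ?posrE ?mulr_gt0 ?exprn_gt0 ?chi2_moment_gt0//.
rewrite ![in X in X <= _]lnM ?posrE ?mulr_gt0 ?exprn_gt0 ?chi2_moment_gt0//.
rewrite lnXn// -[_ *+ p]mulr_natl [ln (n%:R * lambda)]lnM ?posrE//.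
have hC := ln_bin_le (leq_trans kn nN) k0; rewrite ln_div ?posrE// in hC.
have hk := ln_chi2_moment_le p k0; have hn := ln_chi2_moment_le p n0.
have h1 := ln_chi2_moment1_ge p0.
rewrite -/t in hk hn h1.
have near_t (m : R) : 0 < m -> m <= n%:R ->
    xlnx (m + t) - xlnx t <= m * ln t + 2 * m / lambda.
  move=> m0 mn; have mt : 0 < m + t by rewrite addr_gt0.
  have := @xlnx_convex t (m + t) (ltW t0) mt; rewrite addrK.
  move=> /le_trans; apply.
  have -> : m + t = t * (1 + m / t) by field; rewrite gt_eqF.
  have mt1 : 0 < 1 + m / t by rewrite addr_gt0// divr_gt0.
  rewrite lnM ?posrE// mulrDr lerD2l -mulrA mulrCA ler_wpM2l ?(ltW m0)//.
  have : ln (1 + m / t) <= m / t.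
    by apply: le_ln1Dx; rewrite (lt_trans (ltrN10 _))// divr_gt0.
  move=> /le_trans; apply; rewrite ler_pdivrMr// mulrAC ler_pdivlMr//.
  apply: le_trans (_ : n%:R * lambda <= _); first by rewrite ler_wpM2r// ltW.
  by [].
have gk := near_t _ kR knR; have gn := near_t _ nR (lexx _).
have kl : 2 * k%:R / lambda <= 2 * n%:R / lambda.
  by rewrite ler_pM2r ?invr_gt0// ler_pM2l.
have lnt : ln t <= ln (n%:R * lambda) by rewrite ler_ln ?posrE.
have lnnl : ln (n%:R * lambda) = ln n%:R + ln lambda by rewrite lnM ?posrE.
have tl : t * ln t <= t * ln (n%:R * lambda) by rewrite ler_wpM2l// ltW.
have kt : k%:R * ln t <= k%:R * ln (n%:R * lambda) by rewrite ler_wpM2l// ltW.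
have nt : n%:R * ln t <= n%:R * ln (n%:R * lambda) by rewrite ler_wpM2l// ltW.
rewrite lnnl in tl kt nt lnt *; rewrite /xlnx in gk gn hk hn h1.
have -> : 2 * (ln 'C(N, k)%:R + ln (chi2_moment k p)%:R + ln (chi2_moment n p)%:R -
   (ln (chi2_moment 1 p)%:R + p%:R * (ln n%:R + ln lambda))) =
  2 * ln 'C(N, k)%:R + 2 * ln (chi2_moment k p)%:R + 2 * ln (chi2_moment n p)%:R -
  2 * ln (chi2_moment 1 p)%:R - t * (ln n%:R + ln lambda) :> R by rewrite /t; ring.
have -> : 4 * n%:R / lambda = 2 * n%:R / lambda + 2 * n%:R / lambda by ring.
lra.
Qed.

End entropy.

(** * Smallness of delta and exponential decay *)

Section thresholds.
Variable R : realType.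
Variables (eps c rho : R).
Hypotheses (eps0 : 0 < eps) (c1 : 1 < c) (rho0 : 0 < rho) (rho1 : rho < 1).

(** [L_delta] tends to 1 with [delta], so that a factor [1 + eps] brings it
    above 1. *)
Lemma L_delta_threshold : exists2 d0 : R, 0 < d0 &
  forall delta, 0 < delta < 1 -> delta < d0 -> 1 < (1 + eps) * L_delta c delta rho.
Proof.
pose a := rho / (1 - rho); pose q := eps / (1 + eps).
have e1 : 0 < 1 + eps by rewrite addr_gt0.
have r1 : 0 < 1 - rho by rewrite subr_gt0.
have a0 : 0 < a by rewrite divr_gt0.
have q0 : 0 < q by rewrite divr_gt0.
exists (expR (ln q / a)); first exact: expR_gt0.
move=> delta /andP[d0 d1] dq.
have s0 : 0 < delta ^+ 2 * rho ^+ 3 by rewrite mulr_gt0// exprn_gt0.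
have small : (delta ^+ 2 * rho ^+ 3) `^ a < q.
  rewrite -[X in _ < X]lnK ?posrE// /powR gt_eqF// ltr_expR -ltr_pdivlMl//.
  rewrite [_^-1 * _]mulrC; apply: (@le_lt_trans _ _ (ln delta)).
    have -> : delta ^+ 2 * rho ^+ 3 = delta * (delta * rho ^+ 3) by ring.
    have r3 : rho ^+ 3 <= 1 by rewrite exprn_ile1 ?ltW.
    rewrite ler_ln ?posrE ?mulr_gt0 ?exprn_gt0// ger_pMr//.
    by apply: mulr_ile1; rewrite ?r3 ?exprn_ge0 ?(ltW d0) ?(ltW d1) ?(ltW rho0).
  by rewrite -(@expRK R (ln q / a)) ltr_ln ?posrE ?expR_gt0.
have K1 : expR (- ((3 * rho + c) / (1 - rho))) <= 1.
  rewrite -[leRHS]expR0 ler_expR oppr_le0 divr_ge0 ?ltW// addr_gt0 ?mulr_gt0//.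
  by rewrite (lt_trans ltr01).
rewrite /L_delta -/a.
have : expR (- ((3 * rho + c) / (1 - rho))) * (delta ^+ 2 * rho ^+ 3) `^ a < q.
  by apply: le_lt_trans small; rewrite ler_piMl// powR_ge0.
rewrite /q ltr_pdivlMr//; lra.
Qed.

(** The limit of the bound of [ln_tail_le] divided by [n], when [k / n] tends
    to [kappa] and [n / N] to [delta]. *)
Definition tail_rate (delta lambda kappa : R) : R :=
  2 * (kappa * - ln (delta * kappa)) + 3 * kappa - kappa * ln kappa
  + (kappa + 1) * ln lambda + 1 + 4 / lambda - lambda.

(** The argument of the outer logarithm in [U_delta] bounds [lambda] itself as
    soon as [delta] is small, because [lambda] grows like [rho] times the
    logarithm of [1 / (delta^2 rho^3)], and [rho < 1 < c]. Then [ln lambda] is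
    absorbed and the term [eps] keeps the rate negative. *)
Lemma U_delta_threshold : exists2 d0 : R, 0 < d0 &
  forall delta, 0 < delta < 1 -> delta < d0 ->
    0 < 1 + U_delta c delta rho + eps /\
    tail_rate delta (1 + U_delta c delta rho + eps) rho < 0.
Proof.
pose a := (c - rho) / 4.
have a0 : 0 < a by rewrite divr_gt0// subr_gt0 (lt_trans rho1).
have c0 : 0 < c by rewrite (lt_trans ltr01).
(* [b] solves [4 + eps + 2 (a b + ln (c / a)) = 4 a b], and [c - rho = 4 a]. *)
pose b := (4 + eps + 2 * ln (c / a)) / (2 * a).
pose u0 := 1 + 4 / (eps * rho) + `|b|.
have er0 : 0 < 4 / (eps * rho) by rewrite divr_gt0// mulr_gt0.
exists (expR (- u0)); first exact: expR_gt0.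
move=> delta /andP[d0 d1] du.
have lnd : ln delta < - u0 by rewrite -(@expRK R (- u0)) ltr_ln ?posrE ?expR_gt0.
have lnr : ln rho < 0 by rewrite ln_lt0// rho0.
have lE : ln (1 / (delta ^+ 2 * rho ^+ 3)) = - 2 * ln delta - 3 * ln rho.
  rewrite div1r lnV ?posrE ?mulr_gt0 ?exprn_gt0// lnM ?posrE ?exprn_gt0//.
  by rewrite (lnXn 2 d0) (lnXn 3 rho0); ring.
pose u : R := - 2 * ln delta - 3 * ln rho; rewrite /U_delta lE -/u.
have b0 : 0 <= `|b| by [].
have uu0 : u0 <= u by rewrite /u /u0; move: lnd; rewrite /u0; lra.
have u1 : 1 < u by apply: lt_le_trans uu0; rewrite /u0; lra.
have ue : 4 / (eps * rho) < u by apply: lt_le_trans uu0; rewrite /u0; lra.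
have ub : b <= u by apply: le_trans uu0; have := ler_norm b; rewrite /u0; lra.
have cu0 : 0 < c * u by rewrite mulr_gt0// (lt_trans ltr01).
have lncu0 : 0 < ln (c * u) by rewrite ln_gt0// -[X in X < _]mulr1 ltr_pM.
have lncu : ln (c * u) <= a * u + ln (c / a).
  have -> : c * u = (a * u) * (c / a) by field; rewrite gt_eqF.
  have au0 : 0 < a * u by rewrite mulr_gt0// (lt_trans ltr01).
  have ca0 : 0 < c / a by rewrite divr_gt0.
  by rewrite (lnM au0 ca0) lerD2r ltW// ln_sublinear.
pose lambda : R := 1 + (rho * u + (1 + rho) * ln (c * u) + 3 * rho) + eps.
have lE' : lambda =
  1 + (rho * u + (1 + rho) * ln (c * u) + 3 * rho) + eps := erefl.
rewrite -/lambda.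
have lu : rho * u < lambda.
  have : 0 < (1 + rho) * ln (c * u) by rewrite mulr_gt0// addr_gt0.
  by rewrite lE'; move: rho0 eps0; lra.
have l0 : 0 < lambda by apply: lt_trans lu; rewrite mulr_gt0// (lt_trans ltr01).
split=> //.
have l4 : 4 / lambda < eps.
  rewrite ltr_pdivrMr// -ltr_pdivrMl//; apply: lt_trans lu.
  by rewrite -ltr_pdivrMl// mulrCA mulrA -invfM mulrC.
have lcu : lambda <= c * u.
  have a20 : 0 < 2 * a by rewrite (mulr_gt0 _ a0).
  have := ler_wpM2r (ltW a20) ub; rewrite /b divfK ?(gt_eqF a20)// => bu.
  have cE : c = rho + 4 * a by rewrite /a; field.
  have : (1 + rho) * ln (c * u) <= 2 * ln (c * u) by rewrite ler_pM2r//; move: rho1; lra.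
  by rewrite lE' [X in _ <= X * u]cE mulrDl; move: rho0 rho1 eps0; lra.
have lnl : ln lambda <= ln (c * u) by rewrite (ler_ln l0 cu0).
have : (1 + rho) * ln lambda <= (1 + rho) * ln (c * u) by rewrite ler_pM2l// addr_gt0.
rewrite /tail_rate (lnM d0 rho0) => lncl.
have : rho * u = - 2 * (rho * ln delta) - 3 * (rho * ln rho) by rewrite /u; ring.
move: rho0 eps0 lncl lE' l4; move: (ln (c * u)) (ln lambda) => v l; lra.
Qed.

End thresholds.

Lemma to1_exponentially_near (R : realType) (n : nat -> nat) (p : nat -> \bar R)
    (C kappa : R) : 0 < C -> 0 < kappa -> (forall m, (0 <= p m)%E) ->
  (\forall m \near \oo, (1 - p m <= (C * expR (- (kappa * (n m)%:R)))%:E)%E) ->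
  to1_exponentially n p.
Proof.
move=> C0 kappa0 p0 [M _ nearM].
pose D := C + \sum_(m < M) expR (kappa * (n m)%:R).
have S0 : 0 <= \sum_(m < M) expR (kappa * (n m)%:R).
  by apply: sumr_ge0 => m _; exact: expR_ge0.
exists D, kappa; split; first by rewrite ltr_wpDr.
split=> // m; have [Mm|mM] := leqP M m.
  apply: (le_trans (nearM m Mm)); rewrite lee_fin ler_wpM2r ?expR_ge0//.
  by rewrite lerDl.
apply: (@le_trans _ _ 1%E); first by rewrite geeDl// oppe_le0.
rewrite lee_fin expRN ler_pdivlMr ?expR_gt0// mul1r.
rewrite /D (bigD1 (Ordinal mM))//= addrCA lerDl (addr_ge0 (ltW C0))//.
by apply: sumr_ge0 => i _; exact: expR_ge0.
Qed.

Section upper_bound.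
Variables (R : realType) (rho delta : R).
Hypotheses (rho0 : 0 < rho) (delta0 : 0 < delta).
Variables (k n N : nat -> nat).
Hypothesis knN : forall m, (0 < k m)%N /\ (k m <= n m)%N /\ (n m <= N m)%N.
Hypothesis ny : n @ \oo --> \oo.
Hypothesis krho : (k m)%:R / (n m)%:R @[m --> \oo] --> rho.
Hypothesis ndelta : (n m)%:R / (N m)%:R @[m --> \oo] --> delta.
Variable lambda : R.
Hypotheses (lambda0 : 0 < lambda) (rate0 : tail_rate delta lambda rho < 0).

Let cvg_tail_rate :
  tail_rate ((n m)%:R / (N m)%:R) lambda ((k m)%:R / (n m)%:R) @[m --> \oo] -->
  tail_rate delta lambda rho.
Proof.
have dr0 : 0 < delta * rho by rewrite mulr_gt0.
have ln_cvg (u : nat -> R) (l : R) : 0 < l -> u m @[m --> \oo] --> l ->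
    ln (u m) @[m --> \oo] --> ln l.
  by move=> l0 ul; apply: (cvg_comp _ _ ul); exact: continuous_ln.
have cc (r : R) : r @[_ --> \oo] --> r by exact: cvg_cst.
rewrite /tail_rate; apply: cvgB; last exact: cc.
apply: cvgD; last exact: cc.
apply: cvgD; last exact: cc.
apply: cvgD; last by apply: cvgM; [apply: cvgD => //; exact: cc|exact: cc].
apply: cvgB; last by apply: cvgM => //; exact: ln_cvg.
apply: cvgD; last by apply: cvgM => //; exact: cc.
apply: cvgM; first exact: cc.
apply: cvgM => //; apply: cvgN; apply: ln_cvg => //.
exact: cvgM.
Qed.

Let tail m p : R :=
  'C(N m, k m)%:R * (chi2_moment (k m) p)%:R * (chi2_moment (n m) p)%:R /
    ((chi2_moment 1 p)%:R * ((n m)%:R * lambda) ^+ p).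

(** Half of the negative rate is lost to the fluctuation of [k / n] and
    [n / N], and half of the rest absorbs the term [ln (n lambda)], which is
    bounded by [a n] plus a constant; this leaves the decay [a / 2]. *)
Lemma tail_exponential : exists C kappa : R, [/\ 0 < C, 0 < kappa &
  \forall m \near \oo, exists p, tail m p <= C * expR (- (kappa * (n m)%:R))].
Proof.
pose G := tail_rate delta lambda rho; have G0 : G < 0 := rate0.
pose a := - G / 4; have a0 : 0 < a by rewrite divr_gt0// oppr_gt0.
exists (expR ((1 + ln (lambda / a)) / 2)), (a / 2); split.
- exact: expR_gt0.
- by rewrite divr_gt0.
near=> m; have [k0 [kn nN]] := knN m.
have n0 := leq_trans k0 kn.
have kR : 0 < (k m)%:R :> R by rewrite ltr0n.
have nR : 0 < (n m)%:R :> R by rewrite ltr0n.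
have NR : 0 < (N m)%:R :> R by rewrite ltr0n (leq_trans n0).
have nl0 : 0 < (n m)%:R * lambda by rewrite mulr_gt0.
pose p := Num.truncn ((n m)%:R * lambda / 2); exists p.
have nl4 : 4 <= (n m)%:R * lambda.
  rewrite -ler_pdivrMr//; near: m.
  have [M _ hM] := ny (nbhs_infty_ge (Num.truncn (4 / lambda)).+1).
  exists M => // m Mm; apply: le_trans (ltW (truncnS_gt _)) _.
  by rewrite ler_nat; exact: hM.
have Gm : tail_rate ((n m)%:R / (N m)%:R) lambda ((k m)%:R / (n m)%:R) <= G / 2.
  near: m; apply: (cvgr_le _ cvg_tail_rate).
  by rewrite -/G; lra.
have /andP[p1 p2] : p%:R <= (n m)%:R * lambda / 2 < p.+1%:R.
  by rewrite truncn_le ?truncnS_gt// divr_ge0// ltW.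
have pl : 2 * p%:R <= (n m)%:R * lambda by move: p1; lra.
have lp : (n m)%:R * lambda - 2 <= 2 * p%:R by move: p2; rewrite -[p.+1%:R]natr1; lra.
have := ln_tail_le k0 kn nN lambda0 nl4 pl lp; rewrite -/(tail m p) => tm.
have tail0 : 0 < tail m p.
  rewrite /tail divr_gt0 ?mulr_gt0 ?chi2_moment_gt0 ?exprn_gt0//.
  by rewrite ltr0n bin_gt0 (leq_trans kn).
rewrite -[tail m p]lnK ?posrE// -expRD ler_expR.
have lnnl : ln ((n m)%:R * lambda) <= a * (n m)%:R - 1 + ln (lambda / a).
  have -> : (n m)%:R * lambda = (a * (n m)%:R) * (lambda / a) by field; rewrite gt_eqF.
  have an0 : 0 < a * (n m)%:R by rewrite mulr_gt0.
  by rewrite (lnM an0 (divr_gt0 lambda0 a0)) lerD2r ln_le_sub1.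
have rateE : 2 * ((k m)%:R * ln ((N m)%:R / (k m)%:R)) + 3 * (k m)%:R +
    (k m)%:R * ln ((n m)%:R / (k m)%:R) + ((k m)%:R + (n m)%:R) * ln lambda + (n m)%:R
    + 4 * (n m)%:R / lambda - (n m)%:R * lambda =
    (n m)%:R * tail_rate ((n m)%:R / (N m)%:R) lambda ((k m)%:R / (n m)%:R).
  rewrite /tail_rate.
  have -> : (n m)%:R / (N m)%:R * ((k m)%:R / (n m)%:R) = (k m)%:R / (N m)%:R :> R.
    by field; rewrite !gt_eqF.
  rewrite !ln_div ?posrE//; field; rewrite !gt_eqF//.
rewrite rateE in tm.
have := ler_wpM2l (ltW nR) Gm; move: tm lnnl.
have GE : G = - 4 * a by rewrite /a; field.
rewrite GE; lra.
Unshelve. all: by end_near. Qed.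

End upper_bound.

Theorem theorem3 (R : realType) (eps c : R) (heps : 0 < eps) (hc : 1 < c)
    (rho : R) (hrho : 0 < rho < 1) :
  exists delta0 : R, 0 < delta0 /\
    forall (delta : R), 0 < delta < 1 -> delta < delta0 ->
    forall (k n N : nat -> nat),
      (forall m, (0 < k m)%N /\ (k m <= n m)%N /\ (n m <= N m)%N) ->
      n @ \oo --> \oo ->
      (k m)%:R / (n m)%:R @[m --> \oo] --> rho ->
      (n m)%:R / (N m)%:R @[m --> \oo] --> delta ->
    forall (d : nat -> measure_display) (T : forall m, measurableType (d m))
      (P : forall m, probability (T m) R)
      (X : forall m, 'I_(n m) * 'I_(N m) -> {RV (P m) >-> R}),
      (forall m, iid_gaussian_entries (X m)) ->
      to1_exponentially n (fun m => P m [set w |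
        lower_RIC (k m) (random_matrix (X m) w) < (1 + eps) * L_delta c delta rho])
      /\
      to1_exponentially n (fun m => P m [set w |
        upper_RIC (k m) (random_matrix (X m) w) < U_delta c delta rho + eps]).
Proof.
have /andP[rho0 rho1] := hrho.
have [dL dL0 thrL] := L_delta_threshold heps hc rho0 rho1.
have [dU dU0 thrU] := U_delta_threshold heps hc rho0 rho1.
exists (Num.min dL dU); split; first by rewrite lt_min dL0.
move=> delta hdelta; rewrite lt_min => /andP[deltaL deltaU].
move=> k n N knN ny krho ndelta d T P X iidX.
have /andP[delta0 _] := hdelta.
split.
  (* The infimum is nonnegative, so the lower constant never exceeds 1, whereas
     the right-hand side does once delta is small: the event is certain. *)
  exists 1, 1; split=> //; split=> // m; have [k0 [kn nN]] := knN m.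
  have N0 : (0 < N m)%N := leq_trans (leq_trans k0 kn) nN.
  rewrite (_ : [set w | _] = setT); last first.
    apply/seteqP; split=> // w _ /=; apply: le_lt_trans (thrL _ hdelta deltaL).
    rewrite /lower_RIC.
    have [[x _ <-] _] := sparse_quotients_min (random_matrix (X m) w) k0 N0.
    by rewrite gerBl divr_ge0 ?sqr_ge0.
  by rewrite probability_setT subee// lee_fin mul1r expR_ge0.
have [lambda0 rate0] := thrU _ hdelta deltaU.
have [C [kappa [C0 kappa0 tail]]] :=
  tail_exponential rho0 delta0 knN ny krho ndelta lambda0 rate0.
apply: (to1_exponentially_near C0 kappa0) => [m|]; first exact: measure_ge0.
apply: filterS tail => m [p tailp]; have [k0 [kn nN]] := knN m.
have := upper_RIC_tail p k0 kn nN (iidX m) lambda0.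
rewrite (_ : 1 + U_delta c delta rho + eps - 1 = U_delta c delta rho + eps); last by ring.
by move=> /le_trans; apply; rewrite lee_fin.
Qed.
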